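(* $(c>0)$-\textsc{MceaEnum} is in \textbf{PSDelayP}: there is an algorithm that, given a weighted temporal graph $G=(V,E)$ in which every edge has strictly positive cost and vertices $s,z\in V$, enumerates exactly all $(s,z)$-paths that are efficient with respect to arrival time and cost, such that the time until the first output and between any two consecutive outputs is bounded by a polynomial in the input size, and the space used is bounded by a polynomial in the input size.
   Context: A weighted temporal graph $G=(V,E)$ has temporal edges $e=(u,v,t,\lambda,c)$ with $u\neq v$, availability time $t\in\mathbb{N}$, traversal time $\lambda\in\mathbb{N}$, cost $c\in\mathbb{R}_{\ge0}$; it is given as the sequence of its edges sorted by availability time. A temporal $(u,v)$-path is a sequence $(e_1,\ldots,e_k)$, $e_i=(v_i,v_{i+1},t_i,\lambda_i,c_i)\in E$, $v_1=u$, $v_{k+1}=v$, $t_i+\lambda_i\le t_{i+1}$ for $1\le i<k$, visiting each vertex at most once; arrival time $a(P)=t_k+\lambda_k$, cost $c(P)=\sum_i c_i$. An $(s,z)$-path $P$ is efficient w.r.t. arrival time and cost if no $(s,z)$-path $Q$ has ($c(Q)<c(P)$ and $a(Q)\le a(P)$) or ($c(Q)\le c(P)$ and $a(Q)<a(P)$). \textsc{MceaEnum} is the task of enumerating all and only these efficient $(s,z)$-paths; $(c>0)$-\textsc{MceaEnum} is its restriction to graphs with all edge costs strictly positive. An enumeration problem is in \textbf{PSDelayP} if the delay before the first and between any two consecutive outputs is polynomial in the input size and the space used is polynomial in the input size. *)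

(* Defs.v *)
From HB Require Import structures.
From mathcomp Require Import all_boot all_order all_algebra.
From mathcomp Require Import reals.

Set Implicit Arguments.
Unset Strict Implicit.
Unset Printing Implicit Defensive.

Import Order.TTheory GRing.Theory Num.Theory.

(** * Weighted temporal graphs and efficient temporal paths *)

Record tedge (R : realType) (n : nat) := TEdge {
  src : 'I_n;
  dst : 'I_n;
  avail : nat;
  trav : nat;
  cost : R
}.

Section TedgeEqType.
Variables (R : realType) (n : nat).

Definition tuple_of_tedge (e : tedge R n) :=
  (src e, dst e, avail e, trav e, cost e).
Definition tedge_of_tuple (x : 'I_n * 'I_n * nat * nat * R) :=
  let: (u, v, t, l, c) := x in TEdge u v t l c.

Lemma tuple_of_tedgeK : cancel tuple_of_tedge tedge_of_tuple.
Proof. by case. Qed.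

HB.instance Definition _ :=
  Equality.copy (tedge R n) (can_type tuple_of_tedgeK).
End TedgeEqType.

(* The edge set is given as a duplicate-free sequence, sorted by availability
   time with ties broken arbitrarily. *)
Record wtgraph (R : realType) := WTGraph {
  nvert : nat;
  edges : seq (tedge R nvert);
  edges_uniq : uniq edges;
  edges_sorted : sorted leq [seq avail e | e <- edges];
  edges_loopless : all (fun e => src e != dst e) edges;
  edges_cost_ge0 : all (fun e => 0 <= cost e)%R edges
}.

Definition positive_costs (R : realType) (G : wtgraph R) : bool :=
  all (fun e => 0 < cost e)%R (edges G).

Definition follows (R : realType) (n : nat) (e f : tedge R n) : bool :=
  (dst e == src f) && (avail e + trav e <= avail f).

(* A temporal path has at least one edge; the last conjunct says that no vertex
   is visited twice, so there is no temporal (u, u)-path. *)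
Definition tpath (R : realType) (G : wtgraph R) (u v : 'I_(nvert G))
    (P : seq (tedge R (nvert G))) : bool :=
  if P is e :: P' then
    [&& all (mem (edges G)) P, src e == u, path (@follows R (nvert G)) e P',
        dst (last e P') == v & uniq (u :: [seq dst f | f <- P])]
  else false.

Definition arrival (R : realType) (n : nat) (P : seq (tedge R n)) : nat :=
  last 0 [seq avail e + trav e | e <- P].

Definition path_cost (R : realType) (n : nat) (P : seq (tedge R n)) : R :=
  (\sum_(e <- P) cost e)%R.

Definition efficient (R : realType) (G : wtgraph R) (s z : 'I_(nvert G))
    (P : seq (tedge R (nvert G))) : Prop :=
  tpath s z P /\
  ~ (exists Q, tpath s z Q /\
       ((path_cost Q < path_cost P)%R /\ arrival Q <= arrival P \/
        (path_cost Q <= path_cost P)%R /\ arrival Q < arrival P)).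

(** * Model of computation: an additive real RAM

   The memory consists of arrays of natural numbers and arrays of reals; a
   program names finitely many of them by constants.  Reading a cell that was
   never written yields 0.  The operations are addition, truncated subtraction
   and comparison on nat, and only addition and comparison on reals.  There are
   no multiplication, no rounding and no real constants.  Expressions occurring
   in a program have fixed size, so every instruction takes one time unit. *)

Inductive nexpr :=
| NConst of nat
| NRead of nat & nexpr          (* array name, index *)
| NAdd of nexpr & nexpr
| NSub of nexpr & nexpr.

Inductive rexpr :=
| RRead of nat & nexpr
| RAdd of rexpr & rexpr.

Inductive bexpr :=
| NLe of nexpr & nexpr
| RLe of rexpr & rexpr
| BNot of bexpr
| BAnd of bexpr & bexpr.

Inductive instr :=
| NWrite of nat & nexpr & nexpr (* array name, index, value *)
| RWrite of nat & nexpr & rexpr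
| If of bexpr & seq instr & seq instr
| While of bexpr & seq instr
| Print of nexpr                (* append one symbol to the current solution *)
| EndSolution.                  (* the current solution is complete *)

Definition program := seq instr.

Record memory (R : realType) := Memory {
  nmem : seq (seq nat);
  rmem : seq (seq R)
}.

Definition bitlen (k : nat) : nat := (trunc_log 2 k).+1.

(* Naturals count with their bit length, reals count 1.  An array extends up to
   the largest index written so far. *)
Definition space (R : realType) (m : memory R) : nat :=
  \sum_(a <- nmem m) \sum_(k <- a) bitlen k + \sum_(a <- rmem m) size a.

Definition read (T : Type) (d : T) (m : seq (seq T)) (x i : nat) : T :=
  nth d (nth [::] m x) i.

Definition write (T : Type) (d : T) (m : seq (seq T)) (x i : nat) (v : T) :
    seq (seq T) :=
  set_nth [::] m x (set_nth d (nth [::] m x) i v).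

Fixpoint neval (R : realType) (m : memory R) (e : nexpr) : nat :=
  match e with
  | NConst k => k
  | NRead x i => read 0 (nmem m) x (neval m i)
  | NAdd a b => neval m a + neval m b
  | NSub a b => neval m a - neval m b
  end.

Fixpoint reval (R : realType) (m : memory R) (e : rexpr) : R :=
  match e with
  | RRead x i => read 0%R (rmem m) x (neval m i)
  | RAdd a b => (reval m a + reval m b)%R
  end.

Fixpoint beval (R : realType) (m : memory R) (b : bexpr) : bool :=
  match b with
  | NLe a b => neval m a <= neval m b
  | RLe a b => (reval m a <= reval m b)%R
  | BNot a => ~~ beval m a
  | BAnd a b => beval m a && beval m b
  end.

(* [code] is what remains to be executed; its length is bounded in terms of the
   program alone.  [outbuf] and [outputs] form a write-only output tape, which
   does not count as space; every solution is stamped with its output time. *)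
Record config (R : realType) := Config {
  code : seq instr;
  mem_of : memory R;
  clock : nat;
  outbuf : seq nat;
  outputs : seq (nat * seq nat)
}.

Definition step (R : realType) (c : config R) : config R :=
  let: Config p m t w o := c in
  match p with
  | [::] => c
  | i :: k =>
    match i with
    | NWrite x j e =>
        Config k (Memory (write 0 (nmem m) x (neval m j) (neval m e)) (rmem m))
               t.+1 w o
    | RWrite x j e =>
        Config k (Memory (nmem m)
                    (write 0%R (rmem m) x (neval m j) (reval m e)))
               t.+1 w o
    | If b p1 p2 => Config ((if beval m b then p1 else p2) ++ k) m t.+1 w o
    | While b p1 => Config (if beval m b then p1 ++ p else k) m t.+1 w o
    | Print e => Config k m t.+1 (rcons w (neval m e)) o
    | EndSolution => Config k m t.+1 [::] (rcons o (t.+1, w))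
    end
  end.

Definition run (R : realType) (p : program) (m : memory R) (t : nat) :
    config R :=
  iter t (@step R) (Config p m 0 [::] [::]).

(** * Enumeration problems and PSDelayP *)

(* [solution x w]: the word [w] encodes a solution of the instance [x]. *)
Record enum_problem (R : realType) := EnumProblem {
  instance : Type;
  input : instance -> memory R;
  input_size : instance -> nat;
  solution : instance -> seq nat -> Prop
}.

Definition restrict (R : realType) (Pb : enum_problem R)
    (C : instance Pb -> bool) : enum_problem R :=
  @EnumProblem R {x : instance Pb | C x}
    (fun x => input (sval x)) (fun x => input_size (sval x))
    (fun x => solution (sval x)).

Definition enumerates (R : realType) (Pb : enum_problem R)
    (x : instance Pb) (c : config R) : Prop :=
  [/\ code c = [::], uniq [seq o.2 | o <- outputs c] &
      forall w, w \in [seq o.2 | o <- outputs c] <-> solution x w].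

(* The time before the first output, between consecutive outputs, and from the
   last output to termination is at most [D]. *)
Definition delay_le (R : realType) (D : nat) (c : config R) : bool :=
  path (fun t t' => t' <= t + D) 0
       (rcons [seq o.1 | o <- outputs c] (clock c)).

Definition PSDelayP (R : realType) (Pb : enum_problem R) : Prop :=
  exists (p : program) (pd ps : {poly nat}), forall x : instance Pb,
    (exists T : nat,
       enumerates x (run p (input x) T) /\
       delay_le pd.[input_size x]%R (run p (input x) T)) /\
    (forall t : nat,
       space (mem_of (run p (input x) t)) <= ps.[input_size x]%R).

(** * MceaEnum *)

Record mcea_instance (R : realType) := MceaInstance {
  graph : wtgraph R;
  source : 'I_(nvert graph);
  target : 'I_(nvert graph)
}.

Definition mcea_input (R : realType) (x : mcea_instance R) : memory R :=
  let E := edges (graph x) in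
  Memory
    [:: [:: nvert (graph x); size E; val (source x); val (target x)];
        [seq val (src e) | e <- E];
        [seq val (dst e) | e <- E];
        [seq avail e | e <- E];
        [seq trav e | e <- E]]
    [:: [seq cost e | e <- E]].

(* A path is output as the list of the positions of its edges in the input. *)
Definition encode_path (R : realType) (G : wtgraph R)
    (P : seq (tedge R (nvert G))) : seq nat :=
  [seq index e (edges G) | e <- P].

Definition MceaEnum (R : realType) : enum_problem R :=
  @EnumProblem R (mcea_instance R) (@mcea_input R)
    (fun x => nvert (graph x) + space (mcea_input x))
    (fun x w => exists P, efficient (source x) (target x) P /\
                          w = encode_path P).

Definition MceaEnum_pos (R : realType) : enum_problem R :=
  @restrict R (MceaEnum R) (fun x => positive_costs (graph x)).

(* Main.v *)
Require Import Defs.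
From mathcomp Require Import all_boot all_order all_algebra.
From mathcomp Require Import reals.
From mathcomp Require Import boolp zify lra.

Set Implicit Arguments.
Unset Strict Implicit.
Unset Printing Implicit Defensive.

Import Order.TTheory GRing.Theory Num.Theory.

(** Work on edges instead of vertices.  Let F(e) be the least cost of a temporal
walk from s whose last edge is e; Bellman-Ford on the relation "e can follow f"
computes F.  Call (f, e) tight if e can follow f and F(f) + cost(e) = F(e), and
call e good if it enters z and no other edge into z beats it in (F, arrival).
Because costs are positive, a tight chain from s to a good edge visits no vertex
twice (a shortcut would be strictly cheaper), so the efficient paths are exactly
these chains.  Read backwards from a good edge, tight chains have no dead ends:
an edge either leaves s, and then nothing precedes it, or has a tight
predecessor.  Hence a depth-first search finds its next solution after one
ascent and one descent, each scanning the edge list at most once per level. *)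

(** * A program logic for the RAM *)

(** Traversal times may be 0, so edges of equal availability can form cycles under [fol], and no
    order by time gives [F] in one pass; hence the rounds of Bellman-Ford. [F] minimises over walks,
    while efficiency compares paths. The gap is closed at good edges only: their tight chains are
    paths, and every reachable edge into [z] equals or is dominated by a good one. So a label that
    no path attains never hides an efficient path. Two measures govern the search. [rank] is
    exponential and only proves that the search stops; [phase] is quadratic, restarts at each output
    and bounds the delay. Duplicates are excluded without storing any output: solutions appear in
    lexicographic order of their reversed edge lists. The space bound concerns every instant of the
    run, so the program logic carries the memory bound [safe] through all intermediate
    configurations instead of stating it in postconditions. *)

Lemma read_write (T : Type) (d : T) m x i v y j :
  read d (write d m x i v) y j
  = if (y == x) && (j == i) then v else read d m y j.
Proof.
rewrite /read /write nth_set_nth /=; case: eqP => [->|_] //=.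
by rewrite nth_set_nth /=.
Qed.

Notation nrd m := (read 0 (nmem m)).
Notation rrd m := (read 0%R (rmem m)).

Section Logic.
Variables (R : realType) (m0 : memory R) (nrows rrows A : nat).
Implicit Types (m : memory R) (p q : program) (w : seq nat)
  (o : seq (nat * seq nat)).

(* Natural rows 0-4 and real row 0 hold the input and are read-only. *)
Definition safe m :=
  [/\ size (nmem m) <= nrows /\ size (rmem m) <= rrows,
      forall x, x < 5 -> nth [::] (nmem m) x = nth [::] (nmem m0) x,
      forall x, 5 <= x -> size (nth [::] (nmem m) x) <= A /\
                          all (fun v => v <= A) (nth [::] (nmem m) x),
      nth [::] (rmem m) 0 = nth [::] (rmem m0) 0 &
      forall x, size (nth [::] (rmem m) x) <= A].

Lemma input_rows m : safe m ->
  (nrd m 0 = nrd m0 0) * (nrd m 1 = nrd m0 1) * (nrd m 2 = nrd m0 2) *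
  (nrd m 3 = nrd m0 3) * (nrd m 4 = nrd m0 4) * (rrd m 0 = rrd m0 0).
Proof.
by case=> _ inp _ rinp _; split; [do !split|]; rewrite /read ?inp ?rinp.
Qed.

Lemma safe_nwrite m x i v :
  safe m -> 5 <= x < nrows -> i < A -> v <= A ->
  safe (Memory (write 0 (nmem m) x i v) (rmem m)).
Proof.
case=> [[sn sr] inp bnd rinp rbnd] /andP[x5 xn] iA vA.
split=> //=.
- by rewrite size_set_nth geq_max xn sn.
- move=> y y5; rewrite nth_set_nth /=.
  by rewrite (ltn_eqF (leq_trans y5 x5)) inp.
- move=> y y5; rewrite nth_set_nth /=; case: eqP => [?|_]; last exact: bnd.
  have [sb ab] := bnd x x5; rewrite size_set_nth geq_max iA sb.
  split=> //; apply/(all_nthP 0) => j _; rewrite nth_set_nth /=.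
  case: eqP => // _; have [js|js] := ltnP j (size (nth [::] (nmem m) x)).
    exact: (all_nthP 0 ab).
  by rewrite nth_default.
Qed.

Lemma safe_rwrite m x i v :
  safe m -> 0 < x < rrows -> i < A ->
  safe (Memory (nmem m) (write 0%R (rmem m) x i v)).
Proof.
case=> [[sn sr] inp bnd rinp rbnd] /andP[x0 xn] iA.
split=> //=.
- by rewrite size_set_nth geq_max xn sr.
- by rewrite nth_set_nth /= (ltn_eqF x0).
- move=> y; rewrite nth_set_nth /=; case: eqP => [_|_] //.
  by rewrite size_set_nth geq_max iA rbnd.
Qed.

(** Safety is demanded of each configuration passed, because the space bound quantifies over all
    times and not only over the final one. *)
Inductive reach : config R -> config R -> Prop :=
| reach_refl c : safe (mem_of c) -> reach c c
| reach_step c c' : safe (mem_of c) -> reach (step c) c' -> reach c c'.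

Lemma reach_trans c1 c2 c3 : reach c1 c2 -> reach c2 c3 -> reach c1 c3.
Proof. by elim=> // c c' sc _ ih /ih; apply: reach_step. Qed.

Lemma reach_iter c c' : reach c c' ->
  exists T, iter T (@step R) c = c' /\
    forall t, t <= T -> safe (mem_of (iter t (@step R) c)).
Proof.
elim=> [{}c sc|{}c {}c' sc _ [T [eT sT]]].
  by exists 0; split=> // t; rewrite leqn0 => /eqP->.
exists T.+1; split=> [|[|t] //]; first by rewrite iterSr.
by rewrite iterSr; apply: sT.
Qed.

(** Total correctness, with clock and output visible to [Q]. Quantifying over the remaining code [k]
    makes sequencing a mere concatenation, as the machine keeps its code as one flat list. *)
Definition wp p (Q : memory R -> nat -> seq nat -> seq (nat * seq nat) -> Prop)
    m t w o :=
  forall k, exists m' t' w' o',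
    [/\ reach (Config (p ++ k) m t w o) (Config k m' t' w' o'),
        safe m' & Q m' t' w' o'].

Lemma wp_nil Q m t w o : safe m -> Q m t w o -> wp [::] Q m t w o.
Proof. by move=> sm q k; exists m, t, w, o; split=> //; apply: reach_refl. Qed.

Lemma wp_weaken p
    (Q Q' : memory R -> nat -> seq nat -> seq (nat * seq nat) -> Prop) m t w o :
  wp p Q m t w o ->
  (forall m' t' w' o', safe m' -> Q m' t' w' o' -> Q' m' t' w' o') ->
  wp p Q' m t w o.
Proof.
move=> h QQ' k; have [m' [t' [w' [o' [r s q]]]]] := h k.
by exists m', t', w', o'; split=> //; apply: QQ'.
Qed.

Lemma wp_cat p q Q m t w o :
  wp p (wp q Q) m t w o -> wp (p ++ q) Q m t w o.
Proof.
move=> h k; have [m1 [t1 [w1 [o1 [r1 s1 h1]]]]] := h (q ++ k).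
have [m2 [t2 [w2 [o2 [r2 s2 h2]]]]] := h1 k.
exists m2, t2, w2, o2; split=> //; rewrite -catA.
exact: reach_trans r1 r2.
Qed.

Lemma wp_nwrite x j e p Q m t w o : safe m -> 5 <= x < nrows ->
  neval m j < A -> neval m e <= A ->
  (forall m', safe m' ->
     nrd m' = (fun y i =>
        if (y == x) && (i == neval m j) then neval m e else nrd m y i) ->
     rrd m' = rrd m -> wp p Q m' t.+1 w o) ->
  wp (NWrite x j e :: p) Q m t w o.
Proof.
move=> sm xb jb eb h k; have sm' := safe_nwrite sm xb jb eb.
have [|//|m2 [t2 [w2 [o2 [r2 s2 h2]]]]] := h _ sm' _ _ k.
  by apply/funext => y; apply/funext => i; rewrite /= read_write.
by exists m2, t2, w2, o2; split=> //; apply: reach_step.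
Qed.

Lemma wp_rwrite x j e p Q m t w o : safe m -> 0 < x < rrows ->
  neval m j < A ->
  (forall m', safe m' ->
     rrd m' = (fun y i =>
        if (y == x) && (i == neval m j) then reval m e else rrd m y i) ->
     nrd m' = nrd m -> wp p Q m' t.+1 w o) ->
  wp (RWrite x j e :: p) Q m t w o.
Proof.
move=> sm xb jb h k; have sm' := safe_rwrite (reval m e) sm xb jb.
have [|//|m2 [t2 [w2 [o2 [r2 s2 h2]]]]] := h _ sm' _ _ k.
  by apply/funext => y; apply/funext => i; rewrite /= read_write.
by exists m2, t2, w2, o2; split=> //; apply: reach_step.
Qed.

Lemma wp_if b p1 p2 p Q m t w o : safe m ->
  wp ((if beval m b then p1 else p2) ++ p) Q m t.+1 w o ->
  wp (If b p1 p2 :: p) Q m t w o.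
Proof.
move=> sm h k; have [m2 [t2 [w2 [o2 [r2 s2 h2]]]]] := h k.
exists m2, t2, w2, o2; split=> //; apply: reach_step => //=.
by move: r2; rewrite -catA.
Qed.

Lemma wp_print e p Q m t w o : safe m ->
  wp p Q m t.+1 (rcons w (neval m e)) o -> wp (Print e :: p) Q m t w o.
Proof.
move=> sm h k; have [m2 [t2 [w2 [o2 [r2 s2 h2]]]]] := h k.
by exists m2, t2, w2, o2; split=> //; apply: reach_step.
Qed.

Lemma wp_end p Q m t w o : safe m ->
  wp p Q m t.+1 [::] (rcons o (t.+1, w)) -> wp (EndSolution :: p) Q m t w o.
Proof.
move=> sm h k; have [m2 [t2 [w2 [o2 [r2 s2 h2]]]]] := h k.
by exists m2, t2, w2, o2; split=> //; apply: reach_step.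
Qed.

Lemma wp_while b body p
    (Inv : nat -> memory R -> nat -> seq nat -> seq (nat * seq nat) -> Prop)
    Q m t w o n :
  (forall n m t w o, safe m -> Inv n m t w o ->
     if beval m b
     then wp body (fun m' t' w' o' => exists2 n', n' < n & Inv n' m' t' w' o')
             m t.+1 w o
     else wp p Q m t.+1 w o) ->
  safe m -> Inv n m t w o -> wp (While b body :: p) Q m t w o.
Proof.
move=> h; elim/ltn_ind: n m t w o => n ih m t w o sm inv k.
have := h n m t w o sm inv; case: ifP => bE hb.
  have [m1 [t1 [w1 [o1 [r1 s1 [n' n'n inv']]]]]] := hb (While b body :: p ++ k).
  have [m2 [t2 [w2 [o2 [r2 s2 h2]]]]] := ih n' n'n _ _ _ _ s1 inv' k.
  exists m2, t2, w2, o2; split=> //; apply: reach_step => //=.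
  by rewrite bE; apply: reach_trans r1 r2.
have [m2 [t2 [w2 [o2 [r2 s2 h2]]]]] := hb k.
by exists m2, t2, w2, o2; split=> //; apply: reach_step => //=; rewrite bE.
Qed.

(** The special case for preprocessing: a time budget [n] and an untouched output, so that its whole
    cost can be charged to the first delay. *)
Definition calc p n (P : memory R -> Prop) m := safe m -> forall t w o,
  wp p (fun m' t' w' o' => [/\ P m', t' <= t + n, w' = w & o' = o]) m t w o.

Lemma calc_safe p n P m : (safe m -> calc p n P m) -> calc p n P m.
Proof. by move=> h sm; apply: h. Qed.

Lemma calc_nil n (P : memory R -> Prop) m : P m -> calc [::] n P m.
Proof. by move=> Pm sm t w o; apply: wp_nil => //; rewrite leq_addr. Qed.

Lemma calc_weaken p n n' (P P' : memory R -> Prop) m : calc p n P m ->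
  n <= n' -> (forall m', safe m' -> P m' -> P' m') -> calc p n' P' m.
Proof.
move=> h nn' PP' sm t w o; apply: wp_weaken (h sm t w o) _.
by move=> m' t' w' o' s' [P1 t1 -> ->]; split=> //; [exact: PP'|lia].
Qed.

Lemma calc_nwrite x j e p n P m : 
  (safe m -> [/\ 5 <= x < nrows, neval m j < A & neval m e <= A]) ->
  (forall m', safe m -> 
     nrd m' = (fun y i =>
        if (y == x) && (i == neval m j) then neval m e else nrd m y i) ->
     rrd m' = rrd m -> calc p n P m') ->
  calc (NWrite x j e :: p) n.+1 P m.
Proof.
move=> hs h sm t w o; have [xb jb eb] := hs sm.
apply: wp_nwrite => // m' s' nE rE.
apply: wp_weaken (h m' sm nE rE s' t.+1 w o) _.
by move=> m2 t2 w2 o2 _ [? ? -> ->]; split=> //; lia.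
Qed.

Lemma calc_rwrite x j e p n P m : 
  (safe m -> 0 < x < rrows /\ neval m j < A) ->
  (forall m', safe m -> 
     rrd m' = (fun y i =>
        if (y == x) && (i == neval m j) then reval m e else rrd m y i) ->
     nrd m' = nrd m -> calc p n P m') ->
  calc (RWrite x j e :: p) n.+1 P m.
Proof.
move=> hs h sm t w o; have [xb jb] := hs sm.
apply: wp_rwrite => // m' s' nE rE.
apply: wp_weaken (h m' sm nE rE s' t.+1 w o) _.
by move=> m2 t2 w2 o2 _ [? ? -> ->]; split=> //; lia.
Qed.

Lemma calc_if b p1 p2 p n P m :
  calc ((if beval m b then p1 else p2) ++ p) n P m ->
  calc (If b p1 p2 :: p) n.+1 P m.
Proof.
move=> h sm t w o; apply: wp_if => //.
apply: wp_weaken (h sm t.+1 w o) _.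
by move=> m2 t2 w2 o2 _ [? ? -> ->]; split=> //; lia.
Qed.

Lemma calc_wp p q n P Q m t w o : calc p n P m -> safe m ->
  (forall m' t', safe m' -> P m' -> t' <= t + n -> wp q Q m' t' w o) ->
  wp (p ++ q) Q m t w o.
Proof.
move=> cp sm h; apply: wp_cat; apply: wp_weaken (cp sm t w o) _.
by move=> m' t' w' o' s' [P' t'b -> ->]; apply: h.
Qed.

End Logic.

Definition nvar v := NRead 5 (NConst v).

(* The number of edges is stored in cell 1 of array 0. *)
Definition for_loop v (body : program) : program :=
  [:: NWrite 5 (NConst v) (NConst 0);
      While (BNot (NLe (NRead 0 (NConst 1)) (nvar v)))
        (body ++ [:: NWrite 5 (NConst v) (NAdd (nvar v) (NConst 1))])].

Section ForLoop.
Variables (R : realType) (m0 : memory R) (nrows rrows A M : nat).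
Hypotheses (nrows5 : 5 < nrows) (A0 : 0 < A) (MA : M <= A)
  (m0M : nrd m0 0 1 = M).
Notation calc := (calc m0 nrows rrows A).

(** Each round pays for the test and the increment besides the body; the 2 is the initial write and
    the failing last test. The invariant is only required on memories given by their read functions,
    so it must not depend on how arrays are represented. *)
Lemma calc_for v body n (I : nat -> memory R -> Prop) m : v < A ->
  (forall i m, I i m -> nrd m 5 v = i) ->
  (forall m', nrd m' = (fun y i =>
        if (y == 5) && (i == v) then 0 else nrd m y i) ->
     rrd m' = rrd m -> I 0 m') ->
  (forall i m, i < M -> I i m ->
    calc body n (fun m' => nrd m' 5 v = i /\
      forall m'', nrd m'' = (fun y j =>
        if (y == 5) && (j == v) then i.+1 else nrd m' y j) ->
     rrd m'' = rrd m' -> I i.+1 m'') m) ->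
  calc (for_loop v body) (2 + M * n.+2) (I M) m.
Proof.
move=> vA Iv I0 Istep; rewrite /for_loop /=.
apply: calc_nwrite => [sm|m1 sm n1 r1]; first by split=> //=; lia.
move=> s1 t w o.
pose Inv k m2 t' w' (o' : seq (nat * seq nat)) :=
  exists i, [/\ i <= M /\ k = M - i, I i m2, t' <= t + i * n.+2, w' = w & o' = o].
apply: (@wp_while _ _ _ _ _ _ _ _ Inv _ _ _ _ _ M) => //; last first.
  by exists 0; rewrite subn0 addn0; split=> //; apply: I0.
move=> k m2 t2 w2 o2 s2 [i [[iM kE] Ii tb -> ->]] /=.
rewrite (Iv i m2 Ii).
rewrite (input_rows s2) m0M -ltnNge; case: ltnP => iM'.
  apply: calc_wp (Istep i m2 iM' Ii) s2 _ => m3 t3 s3 [m3v h3] t3b.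
  have e3 : neval m3 (NAdd (nvar v) (NConst 1)) = i.+1.
    by rewrite /= m3v addn1.
  apply: wp_nwrite => //; first by rewrite e3; lia.
  move=> m4 s4 n4 r4; apply: wp_nil => //; exists (M - i.+1); first lia.
  exists i.+1; split=> //; last by rewrite mulSn; lia.
  by apply: h3; rewrite ?n4 ?e3.
apply: wp_nil => //; have -> : M = i by lia.
by split=> //; lia.
Qed.
End ForLoop.

(** * Temporal walks on edge indices *)

(** Induction on the number of elements below [x]: passing to some [y] below [x] loses at least [y]
    itself. *)
Lemma minimal_below (T : eqType) (r : rel T) (s : seq T) x :
  irreflexive r -> transitive r -> x \in s ->
  exists y, [/\ y \in s, (y == x) || r y x & all (fun u => ~~ r u y) s].
Proof.
move=> irr tr; have [n] := ubnP (count (r^~ x) s).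
elim: n x => // n ih x; rewrite ltnS => cn xs.
case: (boolP (has (r^~ x) s)) => [/hasP[y ys ryx]|]; last first.
  by rewrite -all_predC => h; exists x; rewrite eqxx.
have [|u [us uy um]] := ih y _ ys; last first.
- exists u; split=> //; apply/orP; right.
  by case/orP: uy => [/eqP->//|/tr]; exact.
- apply: leq_trans cn; have := count_predUI (r^~ y) (pred1 y) s.
  have -> : count (predI (r^~ y) (pred1 y)) s = 0.
    apply/eqP; rewrite -leqn0 leqNgt -has_count; apply/hasPn => u _ /=.
    by apply/andP => -[/[swap] /eqP->]; rewrite irr.
  have : 0 < count (pred1 y) s by rewrite -has_count has_pred1.
  have : count (predU (r^~ y) (pred1 y)) s <= count (r^~ x) s.
    by apply: sub_count => u /= /orP[/tr|/eqP->//]; exact.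
  lia.
Qed.

Lemma sum_uniq_subset (R : realType) (c : nat -> R) (q q' : seq nat) :
  uniq q' -> {subset q' <= q} -> (forall e, e \in q -> 0 <= c e)%R ->
  (\sum_(e <- q') c e <= \sum_(e <- q) c e)%R.
Proof.
elim: q' q => [|x r ih] q /=.
  by move=> _ _ h; rewrite big_nil big_seq; apply: sumr_ge0.
case/andP=> xr ur sub h; have xq : x \in q by apply: sub; rewrite mem_head.
have pq := perm_to_rem xq.
rewrite (perm_big _ pq) !big_cons lerD2l; apply: ih => // y yr.
  have : y \in q by apply: sub; rewrite inE yr orbT.
  rewrite (perm_mem pq) inE => /orP[/eqP yx|//].
  by rewrite -yx yr in xr.
by apply: h; rewrite (perm_mem pq) inE yr orbT.
Qed.

Section Walks.
Variables (R : realType) (M : nat) (sr ds av tr : nat -> nat) (c : nat -> R).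
Variables (s z : nat).
Hypothesis c_gt0 : forall e, e < M -> (0 < c e)%R.

Definition fol f e := (ds f == sr e) && (av f + tr f <= av e).
Definition arr e := av e + tr e.
Definition wcost q : R := (\sum_(e <- q) c e)%R.

(* Lists of edges are in reverse temporal order: [e :: p] ends with [e]. *)
Definition bwalk e p :=
  [&& all (gtn M) (e :: p), path (fun x y => fol y x) e p & sr (last e p) == s].

Lemma bwalk_cons e f p : bwalk e (f :: p) = [&& e < M, fol f e & bwalk f p].
Proof. by rewrite /bwalk /=; rewrite -/(fol f e) -!andbA; do !bool_congr. Qed.

Lemma bwalk_ltn e p : bwalk e p -> e < M.
Proof. by case/and3P=> /andP[]. Qed.

Lemma wcost_cons e q : wcost (e :: q) = (c e + wcost q)%R.
Proof. exact: big_cons. Qed.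

Lemma wcost_ge0 q : all (gtn M) q -> (0 <= wcost q)%R.
Proof.
move=> /allP h; rewrite /wcost big_seq; apply: sumr_ge0 => e /h.
by move/c_gt0/ltW.
Qed.

(** Cutting out the cycles of a walk in the graph whose nodes are the edges leaves distinct edges
    and does not raise the cost. This is why [M] rounds of relaxation suffice. *)
Lemma bwalk_shorten e p : bwalk e p ->
  exists p', [/\ bwalk e p', size p' < M & (wcost (e :: p') <= wcost (e :: p))%R].
Proof.
case/and3P=> bnd pth; case/shortenP: pth => p' pth' up' sub lst.
have sub' : {subset e :: p' <= e :: p}.
  by move=> x; rewrite !inE => /orP[->//|/sub ->]; rewrite orbT.
have bnd' : all (gtn M) (e :: p') by apply/allP => x /sub'; apply: (allP bnd).
exists p'; split; first by rewrite /bwalk bnd' pth'.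
- rewrite -(size_iota 0 M); apply: (uniq_leq_size up') => x /(allP bnd') /=.
  by rewrite mem_iota.
- by apply: sum_uniq_subset => // x /(allP bnd) /= /c_gt0/ltW.
Qed.

(** * Invariants of the Bellman-Ford labels *)

Section Labels.
(* [F e] is meaningful only when the flag [fin e] is positive. *)
Implicit Types (fin : nat -> nat) (F : nat -> R).

Definition sound fin F := forall e, e < M -> 0 < fin e ->
  exists2 p, bwalk e p & wcost (e :: p) = F e.
Definition reached fin F e (x : R) := 0 < fin e /\ (F e <= x)%R.
Definition shortest fin F :=
  sound fin F /\ forall e p, bwalk e p -> reached fin F e (wcost (e :: p)).
(** Only an upper bound on labels, and [sound] ignores lengths: updates are made in place, so after
    [k] rounds a label may already come from a longer walk. *)
Definition complete k fin F := forall e p, bwalk e p -> size p <= k ->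
  reached fin F e (wcost (e :: p)).
Definition improves fin F fin' F' :=
  forall e x, reached fin F e x -> reached fin' F' e x.

Lemma complete_shortest fin F :
  sound fin F -> complete M fin F -> shortest fin F.
Proof.
move=> sn cm; split=> // e p /bwalk_shorten[p' [w' sz le]].
have [f1 f2] := cm _ _ w' (ltnW sz); split=> //; exact: le_trans f2 le.
Qed.

Lemma relax_sound fin F e f :
  sound fin F -> e < M -> f < M -> 0 < fin f -> fol f e ->
  sound (fun x => if x == e then 1 else fin x)
        (fun x => if x == e then (F f + c e)%R else F x).
Proof.
move=> sn eM fM ff fe x xM; case: eqP => [-> _|_]; last exact: sn.
have [p w cp] := sn f fM ff; exists (f :: p).
  by rewrite bwalk_cons eM fe.
by rewrite wcost_cons cp addrC.
Qed.

(** Labels never rise, so bounds collected earlier in a round survive every in-place update. *)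
Lemma relax_improves fin F e f : (fin e = 0 \/ (F f + c e <= F e)%R) ->
  improves fin F (fun x => if x == e then 1 else fin x)
                 (fun x => if x == e then (F f + c e)%R else F x).
Proof.
move=> h x y [f1 f2]; rewrite /reached; case: eqP => [xe|//]; split=> //.
by subst x; case: h => [h|h]; [rewrite h in f1|exact: le_trans h f2].
Qed.
End Labels.

(** * Tight chains and efficient paths *)

Section Tight.
Variables (fin : nat -> nat) (F : nat -> R).
Hypothesis sp : shortest fin F.

Definition tight f e := [&& f < M, 0 < fin f, fol f e & (F f + c e == F e)%R].
Definition cand e := [&& e < M, 0 < fin e & ds e == z].
Definition dom f e := 
  ((F f < F e)%R && (arr f <= arr e)) || ((F f <= F e)%R && (arr f < arr e)).
(** The test [s != z] is needed because walks may return to [s], whereas there is no temporal path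
    from a vertex to itself. *)
Definition good e :=
  [&& s != z, cand e & all (fun f => ~~ (cand f && dom f e)) (iota 0 M)].
Definition sol q := if q is e :: p then
  [&& good e, path (fun x y => tight y x) e p & sr (last e p) == s] else false.

Lemma F_relax f e : e < M -> f < M -> 0 < fin f -> fol f e ->
  0 < fin e /\ (F e <= F f + c e)%R.
Proof.
move=> eM fM ff fe; have [p w cp] := sp.1 f fM ff.
have w' : bwalk e (f :: p) by rewrite bwalk_cons eM fe.
by have [? h] := sp.2 _ _ w'; split=> //; rewrite -cp addrC -wcost_cons.
Qed.

Lemma tight_lt f e : e < M -> tight f e -> (F f < F e)%R.
Proof. by move=> eM /and4P[_ _ _ /eqP<-]; rewrite ltrDl c_gt0. Qed.

Lemma F_source e : e < M -> sr e = s -> 0 < fin e /\ F e = c e.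
Proof.
move=> eM es; have w : bwalk e [::] by rewrite /bwalk /= eM es eqxx.
have [fe le] := sp.2 _ _ w; split=> //; apply/eqP; rewrite eq_le.
move: le; rewrite wcost_cons /wcost big_nil addr0 => -> /=.
have [p wp <-] := sp.1 e eM fe; rewrite wcost_cons lerDl wcost_ge0 //.
by case/and3P: wp => /andP[].
Qed.

(** An edge leaving [s] has label [c e], so a tight predecessor would have label 0, against
    positivity of costs. *)
Lemma tight_nosource f e : e < M -> tight f e -> sr e != s.
Proof.
move=> eM tfe; apply/eqP => es; have [_ Fe] := F_source eM es.
case/and4P: tfe => fM ff fe /eqP; rewrite Fe => h.
have [p wp h2] := sp.1 f fM ff; have : (0 < F f)%R.
  rewrite -h2 wcost_cons ltr_pwDl ?c_gt0 ?wcost_ge0 //.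
  by case/and3P: wp => /andP[].
by move: h; lra.
Qed.

(** Dropping the last edge of an optimal walk leaves an optimal walk: otherwise [F_relax] would give
    [e] a smaller label. *)
Lemma optimal_tight e p : bwalk e p -> wcost (e :: p) = F e ->
  path (fun x y => tight y x) e p.
Proof.
elim: p e => //= f p ih e; rewrite bwalk_cons => /and3P[eM fe w] cF.
have [ff Ff] := sp.2 _ _ w; have fM := bwalk_ltn w.
have [_ Fe] := F_relax eM fM ff fe.
have Ef : F f = wcost (f :: p) by move: cF; rewrite wcost_cons; lra.
rewrite ih // andbT /tight fM ff fe /=; apply/eqP.
by rewrite -cF wcost_cons Ef addrC.
Qed.

Lemma tight_bwalk e p : e < M -> path (fun x y => tight y x) e p ->
  sr (last e p) = s -> bwalk e p /\ wcost (e :: p) = F e.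
Proof.
elim: p e => [|f p ih] e eM /=.
  move=> _ es; split; first by rewrite /bwalk /= eM es eqxx.
  by rewrite wcost_cons /wcost big_nil addr0 (F_source eM es).2.
case/andP=> /and4P[fM ff fe /eqP h] pth /ih[] // w cE; split.
  by rewrite bwalk_cons eM fe.
by rewrite wcost_cons cE -h addrC.
Qed.

Lemma tight_path_exists e : e < M -> 0 < fin e ->
  exists2 p, path (fun x y => tight y x) e p & sr (last e p) = s.
Proof.
move=> eM fe; have [p w cE] := sp.1 e eM fe; exists p.
  exact: optimal_tight.
by case/and3P: w => _ _ /eqP.
Qed.

Lemma tight_child e : e < M -> 0 < fin e -> sr e != s -> exists f, tight f e.
Proof.
move=> eM /(tight_path_exists eM)[[|f p] /=]; first by move=> _ ->; rewrite eqxx.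
by case/andP=> h _ _ _; exists f.
Qed.

Lemma tight_path_mem e p f : e < M ->
  path (fun x y => tight y x) e p -> f \in p ->
  [/\ f < M, 0 < fin f, (F f < F e)%R & arr f <= av e].
Proof.
elim: p e => //= g p ih e eM /andP[tg pth].
have [gM fg /andP[_ ag] _] := and4P tg; have lt := tight_lt eM tg.
rewrite inE => /orP[/eqP->|/(ih g gM pth)[fM ff h1 h2]]; first by [].
by split=> //; [exact: lt_trans lt|move: ag h2; rewrite /arr; lia].
Qed.

Lemma tight_path_size e p : e < M -> path (fun x y => tight y x) e p ->
  size p < M.
Proof.
move=> eM pth; rewrite -(size_iota 0 M).
have : uniq (e :: p) /\ all (gtn M) (e :: p).
  elim: p e eM pth => [|f p ih] e eM pth; first by rewrite /= eM.
  have /andP[tf pth'] := pth; have fM : f < M by case/and4P: tf.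
  have [u1 a1] := ih f fM pth'; rewrite cons_uniq u1 andbT; split.
    apply/negP => /(tight_path_mem eM pth)[_ _]; rewrite ltxx //.
  by move: a1 => /= ->; rewrite eM.
case=> u a; apply: (uniq_leq_size u) => x /(allP a) /=.
by rewrite mem_iota.
Qed.

Lemma tight_path_uniq e p : e < M -> path (fun x y => tight y x) e p ->
  s \notin map ds p /\ uniq (map ds p).
Proof.
elim: p e => //= f p ih e eM /andP[tf pth].
have [fM ff fe /eqP FE] := and4P tf; have [sn ->] := ih f fM pth.
rewrite inE negb_or sn !andbT; split.
  have := tight_nosource eM tf; case/andP: fe => /eqP-> _.
  by rewrite eq_sym.
apply/mapP => -[g gp dE]; have [gM fg Fg ag] := tight_path_mem fM pth gp.
(* [g] reaches the same vertex no later than [f], so [e] may follow [g] directly, and this shortcut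
   would cost less than [F e]. *)
have [|_] := F_relax eM gM fg.
  case/andP: fe => /eqP d1 a1; rewrite /fol -dE d1 eqxx /=.
  by move: ag a1; rewrite /arr; lia.
by rewrite -FE; move: Fg; lra.
Qed.

(* [tpath] and [efficient] for reversed lists of edge indices. *)
Definition btpath q := if q is e :: p then
  [&& bwalk e p, ds e == z & uniq (s :: map ds q)] else false.

Definition efficientb q := btpath q /\
  ~ exists q', btpath q' /\
     ((wcost q' < wcost q)%R /\ arr (head 0 q') <= arr (head 0 q) \/
      (wcost q' <= wcost q)%R /\ arr (head 0 q') < arr (head 0 q)).

Lemma dom_irr : irreflexive dom.
Proof. by move=> e; rewrite /dom !ltxx ltnn andbF. Qed.

Lemma dom_trans : transitive dom.
Proof.
move=> y x w /orP[]/andP[h1 h2] /orP[]/andP[h3 h4]; apply/orP.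
- by left; rewrite (lt_trans h1 h3) (leq_trans h2 h4).
- by left; rewrite (lt_le_trans h1 h3) (leq_trans h2 (ltnW h4)).
- by left; rewrite (le_lt_trans h1 h3) (leq_trans (ltnW h2) h4).
- by right; rewrite (le_trans h1 h3) (ltn_trans h2 h4).
Qed.

Lemma sol_efficient e p : sol (e :: p) -> efficientb (e :: p).
Proof.
case/and3P=> /and3P[sz /and3P[eM fe /eqP de] /allP nd] pth /eqP ls.
have [w cE] := tight_bwalk eM pth ls; have [sn un] := tight_path_uniq eM pth.
split=> /=.
  rewrite w de eqxx /= inE negb_or sz sn un !andbT /=.
  (* [tight_path_uniq] says nothing about the end vertex of [e] itself. An earlier edge into [z] has
     a smaller label and arrives no later, so it would dominate [e]. *)
  apply/mapP => -[f fp zE]; have [fM ff Ff af] := tight_path_mem eM pth fp.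
  have := nd f; rewrite mem_iota fM => /(_ isT)/negP; apply.
  by rewrite /cand fM ff zE eqxx /dom Ff /= (leq_trans af) // leq_addr.
case=> -[|e' p'] [] //= /and3P[w' /eqP de' _]; rewrite cE => h.
have [ff' Fe'] := sp.2 _ _ w'; have e'M := bwalk_ltn w'.
have := nd e'; rewrite mem_iota e'M => /(_ isT)/negP; apply.
rewrite /cand e'M ff' de' eqxx /=; apply/orP.
case: h => -[h1 h2]; [left|right]; rewrite h2 andbT.
  exact: le_lt_trans h1. 
exact: le_trans h1.
Qed.

Lemma good_below e : s != z -> cand e ->
  exists e', [/\ good e', (e' == e) || dom e' e & cand e'].
Proof.
move=> sz ce; pose C := [seq f <- iota 0 M | cand f].
have memC f : (f \in C) = cand f.
  rewrite mem_filter mem_iota /= add0n; case: (boolP (cand f)) => //= /and3P[]//.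
have [|e' [e'C h /allP nd]] := minimal_below dom_irr dom_trans (_ : e \in C).
  by rewrite memC.
exists e'; rewrite memC in e'C; split=> //; rewrite /good sz e'C /=.
apply/allP => f _; apply/negP => /andP[cf df].
by have := nd f; rewrite memC => /(_ cf); rewrite df.
Qed.

(** A good edge [e'] equal to or dominating the last edge [e] ends a genuine path of cost [F e'].
    Efficiency of [q] then forces [e' = e] and cost [F e], and optimality makes the list a tight
    chain. *)
Lemma efficient_sol q : efficientb q -> sol q.
Proof.
case: q => [|e p] [//= /and3P[w /eqP de /andP[sn _]] opt].
have sz : s != z by move: sn; rewrite inE negb_or de => /andP[].
have eM := bwalk_ltn w; have [fe Fe] := sp.2 _ _ w.
have ce : cand e by rewrite /cand eM fe de eqxx.
have [e' [ge' he' ce']] := good_below sz ce.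
have [e'M fe' _] := and3P ce'.
have [p' pth' ls'] := tight_path_exists e'M fe'.
have [w' cE'] := tight_bwalk e'M pth' ls'.
have [t' _] : efficientb (e' :: p').
  by apply: sol_efficient; rewrite /= ge' pth' ls' eqxx.
have nb : ~ (((F e' < wcost (e :: p))%R /\ arr e' <= arr e) \/
           ((F e' <= wcost (e :: p))%R /\ arr e' < arr e)).
  by move=> h; apply: opt; exists (e' :: p'); rewrite cE'.
have ee : e' = e.
  case/orP: he' => [/eqP//|] /orP[]/andP[h1 h2]; case: nb; [left|right].
    by split=> //; apply: lt_le_trans h1 Fe.
  by split=> //; apply: le_trans h1 Fe.
subst e'; have cE : wcost (e :: p) = F e.
  by move: Fe; rewrite le_eqVlt => /orP[/eqP//|lt]; case: nb; left.
rewrite /= ge' (optimal_tight w cE) /=.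
by case/and3P: w.
Qed.

End Tight.
End Walks.

Definition b_or b1 b2 := BNot (BAnd (BNot b1) (BNot b2)).
(** * Computing the labels *)

(* Natural array 5 holds the scalar variables (0: round, 1 and 2: edges of the
   labelling loops, 3: search cursor, 4: search depth, 5: print counter),
   6 flags the edges reachable from s, 7 the good edges, 8 is the search stack;
   real array 1 holds the walk costs [F]. *)
Definition nat_eq a b := BAnd (NLe a b) (NLe b a).
Definition real_eq a b := BAnd (RLe a b) (RLe b a).
Definition src_of e := NRead 1 e.
Definition dst_of e := NRead 2 e.
Definition arr_of e := NAdd (NRead 3 e) (NRead 4 e).
Definition fin_of e := NLe (NConst 1) (NRead 6 e).
Definition follows_of f e :=
  BAnd (nat_eq (dst_of f) (src_of e)) (NLe (arr_of f) (NRead 3 e)).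
Definition nsource := NRead 0 (NConst 2).
Definition ntarget := NRead 0 (NConst 3).
Definition relaxed f e := RAdd (RRead 1 f) (RRead 0 e).

Definition init_labels : program := for_loop 1
  [:: If (nat_eq (src_of (nvar 1)) nsource)
       [:: RWrite 1 (nvar 1) (RRead 0 (nvar 1)); NWrite 6 (nvar 1) (NConst 1)]
       [::]].

Definition relax : program :=
  [:: If (BAnd (fin_of (nvar 2)) (BAnd (follows_of (nvar 2) (nvar 1))
           (b_or (BNot (fin_of (nvar 1)))
                (RLe (relaxed (nvar 2) (nvar 1)) (RRead 1 (nvar 1))))))
       [:: RWrite 1 (nvar 1) (relaxed (nvar 2) (nvar 1));
           NWrite 6 (nvar 1) (NConst 1)]
       [::]].

Definition bellman_ford : program :=
  for_loop 0 (for_loop 1 (for_loop 2 relax)).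

Definition cand_of e := BAnd (fin_of e) (nat_eq (dst_of e) ntarget).
Definition real_lt a b := BNot (RLe b a).
Definition nat_lt a b := BNot (NLe b a).
Definition dom_of f e :=
  b_or (BAnd (real_lt (RRead 1 f) (RRead 1 e)) (NLe (arr_of f) (arr_of e)))
      (BAnd (RLe (RRead 1 f) (RRead 1 e)) (nat_lt (arr_of f) (arr_of e))).

Definition check_dominated : program :=
  [:: If (BAnd (cand_of (nvar 2)) (dom_of (nvar 2) (nvar 1)))
       [:: NWrite 7 (nvar 1) (NConst 0)] [::]].

Definition mark_good : program := for_loop 1
  [:: If (BAnd (BNot (nat_eq nsource ntarget)) (cand_of (nvar 1)))
       (NWrite 7 (nvar 1) (NConst 1) :: for_loop 2 check_dominated)
       [:: NWrite 7 (nvar 1) (NConst 0)]].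

Section Labelling.
Variables (R : realType) (m0 : memory R).
Local Notation M := (nrd m0 0 1).
Local Notation A := (M + 8).
Local Notation calc := (calc m0 9 2 A).
Local Notation safe := (safe m0 9 2 A).
Local Notation s := (nrd m0 0 2).
Local Notation z := (nrd m0 0 3).
Local Notation c := (rrd m0 0).
Local Notation sr := (nrd m0 1).
Local Notation ds := (nrd m0 2).
Local Notation av := (nrd m0 3).
Local Notation tr := (nrd m0 4).
Local Notation bwalk := (bwalk M sr ds av tr s).
Local Notation sound := (sound M sr ds av tr c s).
Local Notation complete := (complete M sr ds av tr c s).
Local Notation shortest := (shortest M sr ds av tr c s).
Local Notation fol := (fol sr ds av tr).
Local Notation wcost := (wcost c).
Local Notation good := (good M ds av tr s z).
Local Notation cand := (cand M ds z).
Local Notation dom := (dom av tr).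
Hypothesis fin0 : forall i, nrd m0 6 i = 0.
Hypothesis c_gt0 : forall e, e < M -> (0 < c e)%R.

Lemma nat_eqE (m : memory R) a b :
  beval m (nat_eq a b) = (neval m a == neval m b).
Proof. by rewrite eqn_leq. Qed.

Lemma b_orE (m : memory R) a b : beval m (b_or a b) = beval m a || beval m b.
Proof. by rewrite /= negb_and !negbK. Qed.

(** The machine has no real constants, hence no infinite cost. Unwritten flags read 0 and mark the
    edges without a label. *)
Lemma init_labels_correct :
  calc init_labels (2 + M * 5)
    (fun m => sound (nrd m 6) (rrd m 1) /\ complete 0 (nrd m 6) (rrd m 1)) m0.
Proof.
pose I i m := [/\ nrd m 5 1 = i, sound (nrd m 6) (rrd m 1) &
  forall e, e < i -> sr e = s -> reached (nrd m 6) (rrd m 1) e (c e)].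
apply: (@calc_weaken _ _ _ _ _ _ (2 + M * 5) _ (I M)) => //; last first.
  move=> m _ [_ sn cm]; split=> // e p w; rewrite leqn0 => /eqP/size0nil pE.
  subst p; case/and3P: w => /= /andP[eM _] _ /eqP es.
  by rewrite wcost_cons /wcost big_nil addr0; apply: cm.
apply: calc_for; rewrite ?addn1 //; try lia.
- by move=> i m [].
- move=> m n r; rewrite /I n /= r; split=> // e eM; by rewrite fin0.
move=> i m iM [vi sn cm]; apply: calc_safe => sm.
apply: calc_if; rewrite nat_eqE /= vi !(input_rows sm) cats0.
case: eqP => ris; last first.
  apply: calc_nil; split=> // m' n' r'; rewrite /I n' /= r'; split=> //.
  move=> e; rewrite ltnS leq_eqVlt => /orP[/eqP->//|]; exact: cm.
apply: calc_rwrite => [_|m1 _ r1 n1]; first by rewrite /= vi; lia.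
apply: calc_nwrite => [_|m2 _ n2 r2]; first by rewrite /= n1 vi; split; lia.
apply: calc_nil; rewrite /= n2 /= n1 vi; split=> // m' n' r'; rewrite /I n'.
have -> : rrd m' 1 = fun y => if y == i then c i else rrd m 1 y.
  by rewrite r' r2 r1 /= vi (input_rows sm).
split=> //=.
- move=> e eM; case: eqP => [-> _|_]; last exact: sn.
  exists [::]; first by rewrite /bwalk /= iM ris eqxx.
  by rewrite wcost_cons /wcost big_nil addr0.
- move=> e; rewrite ltnS leq_eqVlt /reached; case: eqP => [->|_] //=; exact: cm.
Qed.

Section Relax.
Variables k e : nat.
Hypothesis eM : e < M.

Let I f m := [/\ nrd m 5 0 = k, nrd m 5 1 = e, nrd m 5 2 = f,
  sound (nrd m 6) (rrd m 1) /\ complete k (nrd m 6) (rrd m 1) &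
  (forall e' p, e' < e -> bwalk e' p -> size p <= k.+1 ->
     reached (nrd m 6) (rrd m 1) e' (wcost (e' :: p))) /\
  (forall f' p, f' < f -> bwalk e (f' :: p) -> size p <= k ->
     reached (nrd m 6) (rrd m 1) e (wcost (e :: f' :: p)))].

(** If the test fails although [f] is flagged and [e] can follow it, the label of [e] is already
    below [F f + c e]; and [complete k] bounds [F f] by the cost of any walk through [f] with at
    most [k] predecessors. *)
Lemma relax_correct f m : f < M -> I f m ->
  calc relax 3 (fun m' => nrd m' 5 2 = f /\
      forall m'', nrd m'' = (fun y j =>
        if (y == 5) && (j == 2) then f.+1 else nrd m' y j) ->
     rrd m'' = rrd m' -> I f.+1 m'') m.
Proof.
move=> fM [v0 v1 v2 [sn cm] [cm1 cm2]]; apply: calc_safe => sm.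
apply: calc_if; rewrite cats0.
have -> : beval m (BAnd (fin_of (nvar 2)) (BAnd (follows_of (nvar 2) (nvar 1))
           (b_or (BNot (fin_of (nvar 1)))
                (RLe (relaxed (nvar 2) (nvar 1)) (RRead 1 (nvar 1)))))) = 
  [&& 0 < nrd m 6 f, fol f e &
     (nrd m 6 e == 0) || (rrd m 1 f + c e <= rrd m 1 e)%R].
  rewrite [beval _ _]/= -/(b_or _ _) -/(nat_eq _ _) -eqn_leq !v1 !v2 !negbK.
  by rewrite !(input_rows sm) negb_and !negbK -leqNgt leqn0.
case: ifP => [/and3P[ff fe lt]|nupd].
  apply: calc_rwrite => [_|m1 _ r1 n1]; first by rewrite /= v1; lia.
  apply: calc_nwrite => [_|m2 _ n2 r2]; first by rewrite /= n1 v1; split; lia.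
  apply: calc_nil; rewrite /= n2 /= n1 v1 v2; split=> // m' n' r'.
  have F' : rrd m' 1 = fun y => if y == e then (rrd m 1 f + c e)%R else rrd m 1 y.
    by rewrite r' r2 r1 /= v1 v2 (input_rows sm).
  have fin' : nrd m' 6 = fun y => if y == e then 1 else nrd m 6 y.
    by rewrite n'.
  have imp : improves (nrd m 6) (rrd m 1) (nrd m' 6) (rrd m' 1).
    rewrite F' fin'; apply: relax_improves.
    by case/orP: lt => [/eqP|]; [left|right].
  split; first by rewrite n'.
  - by rewrite n'.
  - by rewrite n'.
  - split; first by rewrite F' fin'; apply: relax_sound.
    by move=> e' p w sz; apply: imp; apply: cm.
  split; first by move=> e' p e'e w sz; apply: imp; apply: cm1.
  move=> f' p; rewrite ltnS leq_eqVlt => /orP[/eqP->|f'f] w sz; last first.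
    by apply: imp; apply: cm2.
  rewrite F' fin' /reached eqxx; split=> //.
  move: w; rewrite bwalk_cons => /and3P[_ _ w].
  by have [_] := cm _ _ w sz; rewrite [wcost (e :: _)]wcost_cons addrC lerD2l.
apply: calc_nil; split=> // m' n' r'; rewrite /I n' /= r' v0 v1; split=> //.
split=> // f' p; rewrite ltnS leq_eqVlt => /orP[/eqP->|f'f] w sz; last exact: cm2.
move: w; rewrite bwalk_cons => /and3P[_ fe w].
have [ff Ff] := cm _ _ w sz.
move: nupd; rewrite ff fe /= => /negbT/norP[fine]; rewrite -ltNge => lt.
split; first by rewrite lt0n.
by apply: le_trans (ltW lt) _; rewrite [wcost (e :: _)]wcost_cons addrC lerD2l.
Qed.
End Relax.

Lemma bellman_ford_correct m :
  sound (nrd m 6) (rrd m 1) -> complete 0 (nrd m 6) (rrd m 1) ->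
  calc bellman_ford (2 + M * (2 + M * (2 + M * 5).+2).+2)
    (fun m => shortest (nrd m 6) (rrd m 1)) m.
Proof.
move=> sn cm.
pose I k m := [/\ nrd m 5 0 = k, sound (nrd m 6) (rrd m 1) &
  complete k (nrd m 6) (rrd m 1)].
apply: (@calc_weaken _ _ _ _ _ _ (2 + M * (2 + M * (2 + M * 5).+2).+2) _ (I M)) => //;
  last by move=> m' _ [_ ? ?]; apply: complete_shortest.
apply: calc_for => //; try lia; first by move=> k m' [].
  by move=> m' n' r'; split; rewrite n' ?r'.
move=> k m1 kM [v0 sn1 cm1].
pose J e m := [/\ nrd m 5 0 = k, nrd m 5 1 = e,
  sound (nrd m 6) (rrd m 1) /\ complete k (nrd m 6) (rrd m 1) &
  forall e' p, e' < e -> bwalk e' p -> size p <= k.+1 ->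
     reached (nrd m 6) (rrd m 1) e' (wcost (e' :: p))].
apply: (@calc_weaken _ _ _ _ _ _ (2 + M * (2 + M * 5).+2) _ (J M)) => //; last first.
  move=> m' _ [v0' _ [sn' cm'] h]; split=> // m'' n'' r''.
  rewrite /I n'' /= r''; split=> // e p w; apply: h => //; exact: bwalk_ltn w.
apply: calc_for => //; try lia; first by move=> e m' [].
  by move=> m' n' r'; rewrite /J n' /= r'; split.
move=> e m2 eM [v0' v1 [sn2 cm2] h].
apply: calc_weaken; first apply: (@calc_for _ _ _ _ _ M _ _ _ _ 2 relax 3
  (fun f m => [/\ nrd m 5 0 = k, nrd m 5 1 = e, nrd m 5 2 = f,
  sound (nrd m 6) (rrd m 1) /\ complete k (nrd m 6) (rrd m 1) &
  (forall e' p, e' < e -> bwalk e' p -> size p <= k.+1 ->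
     reached (nrd m 6) (rrd m 1) e' (wcost (e' :: p))) /\
  (forall f' p, f' < f -> bwalk e (f' :: p) -> size p <= k ->
     reached (nrd m 6) (rrd m 1) e (wcost (e :: f' :: p)))])) => //; try lia.
- by move=> f m' [].
- by move=> m' n' r'; rewrite n' /= r'; split.
- move=> f m' fM h'; exact: relax_correct eM f m' fM h'.
move=> m' _ [v0'' v1' _ [sn' cm'] [h1 h2]]; split=> // m'' n'' r''.
rewrite /J n'' /= r''; split=> // e' p; rewrite ltnS leq_eqVlt => /orP[/eqP->|]; last first.
  by move=> e'e; apply: h1.
case: p => [|f p] w sz; first exact: cm'.
apply: h2 => //; move: w; rewrite bwalk_cons => /and3P[_ _]; exact: bwalk_ltn.
Qed.

Lemma mark_good_correct m : 
  calc mark_good (2 + M * (4 + M * 4).+2)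
    (fun m' => [/\ nrd m' 6 = nrd m 6, rrd m' = rrd m &
       forall e, e < M -> (0 < nrd m' 7 e) = good (nrd m 6) (rrd m 1) e]) m.
Proof.
pose fin := nrd m 6; pose F := rrd m 1.
pose I i m' := [/\ nrd m' 5 1 = i, nrd m' 6 = fin, rrd m' = rrd m &
       forall e, e < i -> (0 < nrd m' 7 e) = good fin F e].
apply: (@calc_weaken _ _ _ _ _ _ (2 + M * (4 + M * 4).+2) _ (I M)) => //;
  last by move=> m' _ [].
apply: calc_for => //; try lia; first by move=> k m' [].
  by move=> m' n' r'; rewrite /I n' /= r'.
move=> e m1 eM [v1 n1 r1 h1]; apply: calc_safe => s1.
apply: calc_if; rewrite cats0.
have -> : beval m1 (BAnd (BNot (nat_eq nsource ntarget)) (cand_of (nvar 1))) =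
  (s != z) && cand fin e.
  rewrite /= -!eqn_leq v1 n1 !(input_rows s1) /cand eM /=; exact.
case: ifP => [/andP[sz ce]|nc]; last first.
  apply: calc_nwrite => [_|m2 _ n2 r2]; first by rewrite /= v1; split; lia.
  apply: calc_nil; rewrite /= n2 /= v1; split=> // m' n' r'.
  rewrite /I n' /= r' r2; split=> // e'.
  rewrite ltnS leq_eqVlt; case: eqP => [-> _|_ /=]; last exact: h1.
  by rewrite /good andbA nc.
apply: calc_nwrite => [_|m2 _ n2 r2]; first by rewrite /= v1; split; lia.
pose nd f := all (fun f => ~~ (cand fin f && dom F f e)) (iota 0 f).
have ndS f : nd f.+1 = nd f && ~~ (cand fin f && dom F f e).
  by rewrite /nd -[f.+1]addn1 iotaD all_cat /= andbT.
pose J f m' := [/\ nrd m' 5 1 = e, nrd m' 5 2 = f, nrd m' 6 = fin, rrd m' = rrd m &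
  (forall e, e < nrd m' 5 1 -> (0 < nrd m' 7 e) = good fin F e) /\
  (0 < nrd m' 7 e) = nd f].
apply: (@calc_weaken _ _ _ _ _ _ (2 + M * 4) _ (J M)) => //; last first.
  move=> m' _ [v1' _ n' r' [h h']]; split=> // m'' n'' r''.
  rewrite /I n'' /= r''; split=> // e'; rewrite ltnS leq_eqVlt.
  case/orP => [/eqP->|?]; last by apply: h; rewrite v1'.
  by rewrite h' /good sz ce.
apply: calc_for => //; try lia; first by move=> f m' [].
  move=> m' n' r'; rewrite /J n' /= r' n2 /= r2 v1 eqxx; split=> //.
  split=> // e' e'e; rewrite (ltn_eqF e'e); exact: h1.
move=> f m3 fM [v1' v2 n3 r3 [h2 h3]]; apply: calc_safe => s3.
apply: calc_if; rewrite cats0.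
have -> : beval m3 (BAnd (cand_of (nvar 2)) (dom_of (nvar 2) (nvar 1))) =
  cand fin f && dom F f e.
  rewrite [beval _ _]/= -/(nat_eq _ _) -eqn_leq !v1' !v2 n3 r3 !(input_rows s3).
  by rewrite negb_and !negbK -!ltNge -!ltnNge /cand fM.
case: ifP => df.
  apply: calc_nwrite => [_|m4 _ n4 r4]; first by rewrite /= v1'; split; lia.
  apply: calc_nil; rewrite /= n4 /= v1'; split=> // m' n' r'.
  rewrite /J n' /= r' v1' r4 eqxx; split=> //; split.
    by move=> e' e'e; rewrite (ltn_eqF e'e); apply: h2; rewrite v1'.
  by rewrite ndS df andbF.
apply: calc_nil; split=> // m' n' r'.
rewrite /J n' /= r'; split=> //; split=> //.
by rewrite ndS df andbT.
Qed.

End Labelling.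

(** * Depth-first search *)

(* Lexicographic order, except that nothing precedes the empty list. *)
Fixpoint before (w p : seq nat) : bool :=
  match w, p with
  | _, [::] => false
  | [::], _ :: _ => true
  | x :: w', y :: p' => (x < y) || (x == y) && before w' p'
  end.

Lemma before_nil w : before w [::] = false.
Proof. by case: w. Qed.

(** This lemma and the next two tell which lists each move adds to those already passed: advancing
    the cursor adds the extensions of [rcons p c], a push adds [rcons p c] alone, and a pop adds
    nothing. *)
Lemma before_rconsS w p c :
  before w (rcons p c.+1) = before w (rcons p c) || prefix (rcons p c) w.
Proof.
elim: p w => [|y p ih] [|x w] //=.
  case: w => [|x' w]; rewrite !andbF !orbF prefix0s andbT ltnS leq_eqVlt orbC.
    by rewrite eq_sym.
  by rewrite eq_sym.
by rewrite ih andb_orr orbA (eq_sym y).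
Qed.

Lemma before_rcons0 w p c :
  before w (rcons (rcons p c) 0) = before w (rcons p c) || (w == rcons p c).
Proof.
elim: p w => [|y p ih] [|x w] //=; last by rewrite ih andb_orr orbA eqseq_cons.
rewrite eqseq_cons before_nil andbF orbF.
by case: w => [|x' w] //=; rewrite before_nil !andbF.
Qed.

Lemma before_rcons_max M w p v : all (gtn M) w ->
  before w (rcons (rcons p v) M) = before w (rcons p v.+1).
Proof.
elim: p w => [|y p ih] [|x w] //= /andP[xM wM]; last by rewrite ih.
have -> : before w [:: M] by case: w wM => [|x' w] //= /andP[->].
by rewrite before_nil andbT andbF orbF ltnS [in RHS]leq_eqVlt orbC.
Qed.

Lemma before_irr p : before p p = false.
Proof. by elim: p => //= x p ->; rewrite ltnn eqxx. Qed.

(* The list read as a number in base [B], most significant digit at [B ^ h]; it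
   grows with every move of the search and so bounds their number. *)
Fixpoint rank (B h : nat) (p : seq nat) : nat :=
  if p is x :: p' then x.+1 * B ^ h + rank B h.-1 p' else 0.

Lemma rank_rcons B h p x :
  rank B h (rcons p x) = rank B h p + x.+1 * B ^ (h - size p).
Proof.
elim: p h => [|y p ih] h /=; first by rewrite subn0 addn0.
rewrite ih addnA; congr (_ + _ * B ^ _); lia.
Qed.

(** Digits are [x.+1] with [x <= M], as the cursor may equal [M], and 0 stands for an absent entry;
    hence base [M.+2]. *)
Lemma rank_lt M h p : all (geq M) p ->
  size p <= h.+1 -> rank M.+2 h p < M.+2 ^ h.+1.
Proof.
elim: p h => [|x p ih] h /=; first by rewrite expn_gt0.
case/andP=> xM pM; rewrite ltnS => sz.
have : rank M.+2 h.-1 p < M.+2 ^ h.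
  case: h sz => [|h] /=; last exact: ih.
  by rewrite leqn0 => /eqP/size0nil->.
have : x.+2 * M.+2 ^ h <= M.+2 ^ h.+1 by rewrite expnS leq_mul2r; lia.
by rewrite (mulSn x.+1); lia.
Qed.

Lemma rank_next B h p c : 0 < B ->
  rank B h (rcons p c) < rank B h (rcons p c.+1).
Proof.
move=> B0; rewrite !rank_rcons ltn_add2l ltn_pmul2r ?expn_gt0 ?B0 //.
Qed.

Lemma rank_down B h p : 0 < B -> rank B h p < rank B h (rcons p 0).
Proof. by move=> B0; rewrite rank_rcons mul1n -ltn_subLR // subnn expn_gt0 B0. Qed.

Lemma rank_up M h p v : size p < h ->
  rank M.+2 h (rcons (rcons p v) M) < rank M.+2 h (rcons p v.+1).
Proof.
move=> ph; rewrite !rank_rcons size_rcons -addnA ltn_add2l.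
rewrite (_ : h - size p = (h - (size p).+1).+1); last lia.
rewrite expnS; have := expn_gt0 M.+2 (h - (size p).+1).
by move: (M.+2 ^ _) => y /=; rewrite (mulSn v.+1); nia.
Qed.

(** * The search program and its invariant *)

Definition cur := nvar 3.
Definition depth := nvar 4.
Definition stack_at e := NRead 8 e.
Definition one := NConst 1.
Definition tight_of f e :=
  BAnd (fin_of f) (BAnd (follows_of f e) (real_eq (relaxed f e) (RRead 1 e))).
Definition accept := 
  b_or (BAnd (NLe depth (NConst 0)) (NLe one (NRead 7 cur)))
      (BAnd (NLe one depth) (tight_of cur (stack_at (NSub depth one)))).

Definition print_stack : program :=
  [:: While (NLe one (nvar 5))
       [:: NWrite 5 (NConst 5) (NSub (nvar 5) one); Print (stack_at (nvar 5))]].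
Definition emit : program :=
  NWrite 5 (NConst 5) (NAdd depth one) :: print_stack ++
  [:: EndSolution; NWrite 5 (NConst 3) (NAdd cur one)].
Definition pop : program :=
  [:: NWrite 5 (NConst 4) (NSub depth one);
      NWrite 5 (NConst 3) (NAdd (stack_at depth) one)].
Definition push : program :=
  [:: NWrite 5 (NConst 4) (NAdd depth one); NWrite 5 (NConst 3) (NConst 0)].
Definition dfs_step : program :=
  [:: If (NLe (NRead 0 one) cur) pop
      [:: If accept
          [:: NWrite 8 depth cur; If (nat_eq (src_of cur) nsource) emit push]
          [:: NWrite 5 (NConst 3) (NAdd cur one)]]].
Definition depth_first : program :=
  [:: NWrite 5 (NConst 3) (NConst 0); NWrite 5 (NConst 4) (NConst 0);
      While (BNot (BAnd (NLe (NRead 0 one) cur) (NLe depth (NConst 0)))) dfs_step].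

Section Search.
Variables (R : realType) (m0 : memory R).
Local Notation M := (nrd m0 0 1).
Local Notation A := (M + 8).
Local Notation safe := (safe m0 9 2 A).
Local Notation wp := (wp m0 9 2 A).
Local Notation s := (nrd m0 0 2).
Local Notation z := (nrd m0 0 3).
Local Notation c := (rrd m0 0).
Local Notation sr := (nrd m0 1).
Local Notation ds := (nrd m0 2).
Local Notation av := (nrd m0 3).
Local Notation tr := (nrd m0 4).
Hypothesis c_gt0 : forall e, e < M -> (0 < c e)%R.
Variables (fin : nat -> nat) (F : nat -> R).
Hypothesis sp : shortest M sr ds av tr c s fin F.
Local Notation good := (good M ds av tr s z fin F).
Local Notation tight := (tight M sr ds av tr c fin F).
Local Notation sol := (sol M sr ds av tr c s z fin F).

(* A state of the search: the stack [pre], from the last edge of the path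
   backwards, and the next candidate to put on top of it. *)
Definition ok (pre : seq nat) j := 
  (j < M) && (if pre is e :: p then tight j (last e p) else good j).
Definition chain (pre : seq nat) := 
  if pre is e :: p then good e && path (fun x y => tight y x) e p else true.

Lemma good_ltn e : good e -> e < M.
Proof. by case/and3P=> _ /and3P[]. Qed.

Lemma chain_rcons pre j : chain (rcons pre j) = chain pre && ok pre j.
Proof.
case: pre => [|e p] /=; rewrite /ok.
  by rewrite andbT; apply/idP/andP => [h|[]//]; split=> //; apply: good_ltn.
by rewrite rcons_path -!andbA; do !bool_congr; rewrite /tight; case: (_ < M).
Qed.

Lemma chain_bounds pre : chain pre -> all (gtn M) pre /\ size pre <= M.
Proof.
case: pre => [|e p] //= /andP[ge pth]; have eM := good_ltn ge.
split; last exact: (tight_path_size c_gt0 eM pth).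
rewrite eM; apply/allP => f fp.
by case: (tight_path_mem c_gt0 eM pth fp).
Qed.

Lemma sol_chain q : sol q -> chain q.
Proof. by case: q => // e p /= /and3P[-> ->]. Qed.

Lemma chain_prefix p q : prefix p q -> chain q -> chain p.
Proof.
case: p q => [|x p] [|y q] //= /andP[/eqP-> /prefixP[r ->]] /andP[-> /=].
by rewrite cat_path => /andP[].
Qed.

Lemma sol_rcons pre j : chain pre -> ok pre j -> sr j = s -> sol (rcons pre j).
Proof.
move=> cp okj js; have : chain (rcons pre j) by rewrite chain_rcons cp.
by case: pre {cp okj} => [|e p] /=; rewrite ?last_rcons js eqxx andbT // => ->.
Qed.

Lemma sol_source pre j : sol (rcons pre j) -> sr j = s.
Proof. by case: pre => [|e p] /= => [/andP[_]|/and3P[_ _]] /eqP; rewrite ?last_rcons. Qed.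

Lemma sol_prefix_ok pre j q : sol q -> prefix (rcons pre j) q -> ok pre j.
Proof.
move/sol_chain => cq /chain_prefix/(_ cq).
by rewrite chain_rcons => /andP[].
Qed.

(** An edge leaving [s] has no tight predecessor, so the chain cannot continue. Advancing the cursor
    after an output therefore skips no solution. *)
Lemma sol_prefix_source pre j q : sol q -> prefix (rcons pre j) q -> sr j = s ->
  q = rcons pre j.
Proof.
move=> /sol_chain cq /prefixP[[|f r] qE js]; first by rewrite qE cats0.
have : chain (rcons (rcons pre j) f).
  by apply: (chain_prefix _ cq); rewrite qE -cat_rcons prefix_prefix.
rewrite !chain_rcons => /andP[/andP[_ /andP[jM _]] /andP[_]].
case: pre {qE} => [|e p] /=; rewrite ?last_rcons => tf.
  by have := tight_nosource c_gt0 sp jM tf; rewrite js eqxx.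
by have := tight_nosource c_gt0 sp jM tf; rewrite js eqxx.
Qed.

Lemma ok_child pre j : chain pre -> ok pre j -> sr j != s ->
  exists k, ok (rcons pre j) k.
Proof.
move=> cp okj js; have jM : j < M by case/andP: okj.
have fj : 0 < fin j.
  case/andP: okj => _; case: pre {cp} => [|e p]; last by case/and4P.
  by case/and3P=> _ /and3P[].
have [f tf] := tight_child sp jM fj js.
exists f; rewrite /ok; have [-> _ _ _] := and4P tf => /=.
by case: pre {cp okj} => [|e p] //=; rewrite last_rcons.
Qed.

(** The stack holds the path backwards; printing from the top restores travel order, hence [rev q].
    Each symbol takes a test, a write and a print. *)
Lemma print_stack_wp p Q m t w o q : safe m ->
  size q <= M.+1 -> nrd m 5 5 = size q ->
  (forall i, i < size q -> nrd m 8 i = nth 0 q i) ->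
  (forall m' t', safe m' -> 
     nrd m' = (fun y i => if (y == 5) && (i == 5) then 0 else nrd m y i) ->
     rrd m' = rrd m -> t' <= t + 3 * size q + 1 -> wp p Q m' t' (w ++ rev q) o) ->
  wp (print_stack ++ p) Q m t w o.
Proof.
move=> sm szq v5 st h; rewrite /print_stack /=.
pose I k m' t' w' (o' : seq (nat * seq nat)) :=
  [/\ k <= size q,
      nrd m' = (fun y i => if (y == 5) && (i == 5) then k else nrd m y i),
      rrd m' = rrd m, t' + 3 * k <= t + 3 * size q &
      w' = w ++ rev (drop k q) /\ o' = o].
apply: (@wp_while _ _ _ _ _ _ _ _ I _ _ _ _ _ (size q)) => //; last first.
  split=> //; last by rewrite drop_size cats0.
  apply/funext => y; apply/funext => i.
  by case: andP => // -[/eqP-> /eqP->].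
move=> k m1 t1 w1 o1 s1 [kq n1 r1 tb [-> ->]].
rewrite /= n1 /=; case: posnP => k0.
  subst k; rewrite drop0; apply: h => //; lia.
apply: wp_nwrite => //; try by rewrite /= ?n1 /=; lia.
move=> m2 s2 n2 r2; apply: wp_print => //; apply: wp_nil => //=.
have k1 : k.-1 < size q by lia.
rewrite n2 /= n1 /= subn1; exists k.-1; first lia.
split; first lia.
- by rewrite n2 /= n1 /= subn1; apply/funext => y; apply/funext => i;
    case: ifP => //= ->.
- by rewrite r2.
- lia.
split=> //; rewrite st // rcons_cat -rev_cons; congr (_ ++ rev _).
by rewrite (drop_nth 0 k1) prednK.
Qed.

Definition printing := 3 * M + 12.
(* Bounds the moves left before the next solution is printed; [down] means that an
   acceptable candidate is known to exist at the current level, so that no pop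
   will occur before the next solution. *)
Definition phase (down : bool) (d cu : nat) := 
  if down then (M - d) * M.+2 + (M - cu) 
  else d * M.+2 + (M - cu) + M.+1 * M.+2.

Variable D : nat.
(** The factor of 7 is the largest value of [phase]. The inequality is strict to pay for the cursor
    update that follows [EndSolution]. *)
Hypothesis Dlarge : 7 * (M * M.+2 + M + M.+1 * M.+2) + printing < D.

Record position (pre : seq nat) (cu : nat) (down : bool) (m : memory R) : Prop := {
  pos_depth : nrd m 5 4 = size pre;
  pos_cur : nrd m 5 3 = cu;
  pos_stack : forall i, i < size pre -> nrd m 8 i = nth 0 pre i;
  pos_fin : nrd m 6 = fin;
  pos_F : rrd m 1 = F;
  pos_good : forall e, e < M -> (0 < nrd m 7 e) = good e;
  pos_chain : chain pre;
  pos_inner : all (fun e => sr e != s) pre;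
  pos_le : cu <= M;
  pos_down : down -> exists j, cu <= j /\ ok pre j
}.

Definition printed (p : seq nat) (o : seq (nat * seq nat)) :=
  uniq (map snd o) /\
  forall u, (u \in map snd o) = sol (rev u) && before (rev u) p.

Definition punctual t (o : seq (nat * seq nat)) :=
  path (fun t t' => t' <= t + D) 0 (map fst o) /\ t <= last 0 (map fst o) + D.

(* Every move takes at most 7 steps, and [printing] is reserved for the output. *)
Definition dfs_inv n m t (w : seq nat) o := exists pre cu down,
  [/\ position pre cu down m, w = [::], printed (rcons pre cu) o,
    punctual (t + 7 * phase down (size pre) cu + printing) o &
    n = M.+2 ^ M.+2 - rank M.+2 M.+1 (rcons pre cu)].

Lemma printed_eq p p' o : (forall q, sol q -> before q p = before q p') ->
  printed p o -> printed p' o.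
Proof.
move=> h [u1 u2]; split=> // u; rewrite u2.
by case: (boolP (sol (rev u))) => //= su; rewrite h.
Qed.

Lemma accept_ok pre cu down m : safe m -> position pre cu down m -> cu < M ->
  beval m accept = ok pre cu.
Proof.
move=> sm [d cE st fE FE gE _ _ _ _] cM.
rewrite /accept b_orE [beval _ (BAnd _ _)]/= d cE /ok cM /=.
case/lastP: pre d st => [|p e] d st /=.
  by rewrite d /= orbF gE.
rewrite size_rcons /= in d st *; rewrite !d cE /= subn1 /=.
rewrite st // nth_rcons ltnn eqxx !(input_rows sm) fE FE.
rewrite /tight cM /= -eqn_leq -eq_le /fol.
by case: p {d st} => [|x p] /=; rewrite ?last_rcons.
Qed.
Definition dfs_next n := fun m' t' w' o' =>
  exists2 n', n' < n & dfs_inv n' m' t' w' o'.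

Lemma dfs_nextI pre cu down pre' cu' down' m m' t o :
  position pre cu down m -> position pre' cu' down' m' ->
  rank M.+2 M.+1 (rcons pre cu) < rank M.+2 M.+1 (rcons pre' cu') ->
  printed (rcons pre' cu') o ->
  punctual (t + 7 * phase down' (size pre') cu' + printing) o ->
  dfs_next (M.+2 ^ M.+2 - rank M.+2 M.+1 (rcons pre cu)) m' t [::] o.
Proof.
move=> ps ps' lt pr pu.
exists (M.+2 ^ M.+2 - rank M.+2 M.+1 (rcons pre' cu')); last by exists pre', cu', down'.
apply: ltn_sub2l => //; apply: rank_lt.
  rewrite all_rcons /= (pos_le ps); apply: sub_all (chain_bounds (pos_chain ps)).1.
  by move=> x /= /ltnW.
by rewrite size_rcons ltnS (leq_trans (chain_bounds (pos_chain ps)).2).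
Qed.

Lemma punctual_le t t' o : t <= t' -> punctual t' o -> punctual t o.
Proof. by move=> h [p1 p2]; split=> //; apply: leq_trans p2. Qed.

Lemma pop_correct pre v m t o : safe m -> position (rcons pre v) M false m ->
  printed (rcons (rcons pre v) M) o ->
  punctual (t + 7 * phase false (size pre).+1 M + printing) o ->
  wp pop (dfs_next (M.+2 ^ M.+2 - rank M.+2 M.+1 (rcons (rcons pre v) M)))
    m t.+2 [::] o.
Proof.
move=> sm ps pr pu; have [d cE st fE FE gE ch inn le _] := ps.
have [bnd szb] := chain_bounds ch; rewrite size_rcons in d st szb.
have vM : v < M by move: bnd; rewrite all_rcons => /andP[].
rewrite chain_rcons in ch; rewrite all_rcons in inn.
have stv : nrd m 8 (size pre) = v by rewrite st // nth_rcons ltnn eqxx.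
apply: wp_nwrite => //; try by rewrite /= ?d; lia.
move=> m1 s1 n1 r1; apply: wp_nwrite => //.
- by rewrite /=; lia.
- by rewrite /= n1 /= d subn1 stv; lia.
move=> m2 s2 n2 r2; apply: wp_nil => //.
have n2E : nrd m2 = fun y i => if (y == 5) && (i == 3) then v.+1 else
             if (y == 5) && (i == 4) then size pre else nrd m y i.
  by rewrite n2 /= n1 /= d subn1 stv addn1.
apply: (dfs_nextI (down' := false) (pre' := pre) (cu' := v.+1) ps).
- split; rewrite ?n2E ?r2 ?r1 //=.
  + by move=> i ip; rewrite st 1?ltnW // nth_rcons ip.
  + by case/andP: ch.
  + by case/andP: inn.
- by apply: rank_up; lia.
- apply: printed_eq pr => q /sol_chain/chain_bounds[qM _].
  exact: before_rcons_max.
apply: punctual_le pu; rewrite /phase mulSn subnn; lia.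
Qed.

Lemma skip_correct pre cu down m t o : safe m -> position pre cu down m ->
  cu < M -> ~~ ok pre cu -> printed (rcons pre cu) o ->
  punctual (t + 7 * phase down (size pre) cu + printing) o ->
  wp [:: NWrite 5 (NConst 3) (NAdd cur one)]
   (dfs_next (M.+2 ^ M.+2 - rank M.+2 M.+1 (rcons pre cu))) m (t + 3) [::] o.
Proof.
move=> sm ps cM nok pr pu; have [d cE st fE FE gE ch inn le dn] := ps.
apply: wp_nwrite => //; try by rewrite /= ?cE; lia.
move=> m1 s1 n1 r1; apply: wp_nil => //.
have n1E : nrd m1 = fun y i => if (y == 5) && (i == 3) then cu.+1 else nrd m y i.
  by rewrite n1 /= cE addn1.
apply: (dfs_nextI (down' := down) (pre' := pre) (cu' := cu.+1) ps).
- split; rewrite ?n1E ?r1 //= => /dn[j [cj okj]]; exists j; split=> //.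
  by rewrite ltn_neqAle cj andbT; apply: contraNneq nok => ->.
- by apply: rank_next; lia.
- apply: printed_eq pr => q sq; rewrite before_rconsS.
  case: (boolP (prefix _ _)) => [/(sol_prefix_ok sq)|]; last by rewrite orbF.
  by rewrite (negPf nok).
by apply: punctual_le pu; rewrite /phase; case: (down); lia.
Qed.

(** The new top does not leave [s], so it has a tight predecessor and [down] may be set. One level
    costs [M.+2], more than a fresh scan; coming from an ascent, the reserve [M.+1 * M.+2] pays for
    the whole descent. *)
Lemma push_correct pre cu down m m' t o : safe m' -> position pre cu down m ->
  cu < M -> ok pre cu -> sr cu != s -> printed (rcons pre cu) o ->
  punctual (t + 7 * phase down (size pre) cu + printing) o ->
  nrd m' = (fun y i => if (y == 8) && (i == size pre) then cu else nrd m y i) ->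
  rrd m' = rrd m ->
  wp push (dfs_next (M.+2 ^ M.+2 - rank M.+2 M.+1 (rcons pre cu))) m' (t + 5) [::] o.
Proof.
move=> sm ps cM okc ns pr pu n0 r0; have [d cE st fE FE gE ch inn le dn] := ps.
have ch' : chain (rcons pre cu) by rewrite chain_rcons ch.
have [_ szb] := chain_bounds ch'; rewrite size_rcons in szb.
apply: wp_nwrite => //; try by rewrite /= ?n0 /= ?d; lia.
move=> m1 s1 n1 r1; apply: wp_nwrite => //; try by rewrite /=; lia.
move=> m2 s2 n2 r2; apply: wp_nil => //.
have n2E : nrd m2 = fun y i => if (y == 5) && (i == 3) then 0 else
             if (y == 5) && (i == 4) then (size pre).+1 else
             if (y == 8) && (i == size pre) then cu else nrd m y i.
  by rewrite n2 /= n1 /= n0 /= d addn1.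
apply: (dfs_nextI (down' := true) (pre' := rcons pre cu) (cu' := 0) ps).
- split; rewrite ?n2E ?r2 ?r1 ?r0 //=.
  + by rewrite size_rcons.
  + move=> i; rewrite size_rcons ltnS leq_eqVlt nth_rcons.
    case: eqP => [->|_ /= ip]; first by rewrite ltnn.
    by rewrite ip st.
  + by rewrite all_rcons ns.
  + by move=> _; have [j okj] := ok_child ch okc ns; exists j.
- by apply: rank_down; lia.
- apply: printed_eq pr => q sq; rewrite before_rcons0.
  case: eqP => [qE|]; last by rewrite orbF.
  by rewrite qE in sq; rewrite (sol_source sq) eqxx in ns.
apply: punctual_le pu; rewrite /phase size_rcons.
have -> : M - size pre = (M - (size pre).+1).+1 by lia.
have h : (M - (size pre).+1) * M.+2 <= M * M.+2 by rewrite leq_mul2r leq_subr orbT.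
case: (down); rewrite ?mulSn; lia.
Qed.

Lemma emit_correct pre cu down m m' t o : safe m' -> position pre cu down m ->
  cu < M -> ok pre cu -> sr cu = s -> printed (rcons pre cu) o ->
  punctual (t + 7 * phase down (size pre) cu + printing) o ->
  nrd m' = (fun y i => if (y == 8) && (i == size pre) then cu else nrd m y i) ->
  rrd m' = rrd m ->
  wp emit (dfs_next (M.+2 ^ M.+2 - rank M.+2 M.+1 (rcons pre cu))) m' (t + 5) [::] o.
Proof.
move=> sm ps cM okc es pr pu n0 r0; have [d cE st fE FE gE ch inn le dn] := ps.
have ch' : chain (rcons pre cu) by rewrite chain_rcons ch.
have [_ szb] := chain_bounds ch'; rewrite size_rcons in szb.
have so := sol_rcons ch okc es.
apply: wp_nwrite => //; try by rewrite /= ?n0 /= ?d; lia.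
move=> m1 s1 n1 r1.
have n1E : nrd m1 = fun y i => if (y == 5) && (i == 5) then (size pre).+1 else
             if (y == 8) && (i == size pre) then cu else nrd m y i.
  by rewrite n1 /= n0 /= d addn1.
apply: (print_stack_wp (q := rcons pre cu)) => //.
- by rewrite size_rcons ltnW.
- by rewrite n1E size_rcons.
- move=> i; rewrite n1E /= size_rcons ltnS leq_eqVlt nth_rcons.
  case: eqP => [->|_ /= ip]; first by rewrite ltnn.
  by rewrite ip st.
rewrite size_rcons => m2 t2 s2 n2 r2 t2b; apply: wp_end => //.
apply: wp_nwrite => //; try by rewrite /= ?n2 /= ?n1E /= ?cE; lia.
move=> m3 s3 n3 r3; apply: wp_nil => //.
have n3E : nrd m3 = fun y i => if (y == 5) && (i == 3) then cu.+1 else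
             if (y == 5) && (i == 5) then 0 else
             if (y == 8) && (i == size pre) then cu else nrd m y i.
  rewrite n3 /= n2 /= n1E /= cE addn1; apply/funext => y; apply/funext => i.
  by do !case: ifP.
apply: (dfs_nextI (down' := false) (pre' := pre) (cu' := cu.+1) ps).
- split; rewrite ?n3E ?r3 ?r2 ?r1 ?r0 //=.
  by move=> i ip; rewrite (ltn_eqF ip) st.
- by apply: rank_next; lia.
- case: pr => u1 u2; split.
    rewrite map_rcons rcons_uniq u1 andbT u2 revK so before_irr //.
  move=> u; rewrite map_rcons mem_rcons inE u2 before_rconsS /=.
  have -> : (u == rev (rcons pre cu)) = (rev u == rcons pre cu).
    by rewrite (inv_eq revK).
  case: (boolP (sol (rev u))) => su /=; last first.
    by rewrite orbF; apply: contraNF su => /eqP->.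
  rewrite orbC; congr (_ || _); apply/eqP/idP => [->|pf].
    exact: prefix_refl.
  exact: sol_prefix_source pf es.
case: pu => p1 p2; split; rewrite map_rcons /=.
  rewrite rcons_path p1 /=; apply: leq_trans p2; rewrite /printing; lia.
(* The delay restarts here: the potential is refilled to an ascent from the current depth, measured
   from the new output time. *)
rewrite last_rcons /phase.
have h : size pre * M.+2 <= M * M.+2 by rewrite leq_mul2r (ltnW szb) orbT.
lia.
Qed.

Lemma dfs_correct m t : safe m -> nrd m 6 = fin -> rrd m 1 = F ->
  (forall e, e < M -> (0 < nrd m 7 e) = good e) ->
  t + 2 + 7 * phase false 0 0 + printing <= D ->
  wp depth_first (fun m' t' w' o' =>
    [/\ uniq (map snd o'), forall u, (u \in map snd o') = sol (rev u) &
        punctual t' o']) m t [::] [::].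
Proof.
move=> sm fE FE gE tD.
apply: wp_nwrite => //; try by rewrite /=; lia.
move=> m1 s1 n1 r1; apply: wp_nwrite => //; try by rewrite /=; lia.
move=> m2 s2 n2 r2; rewrite /= in n1 n2.
apply: (@wp_while _ _ _ _ _ _ _ _ dfs_inv _ _ _ _ _
   (M.+2 ^ M.+2 - rank M.+2 M.+1 [:: 0])) => //; last first.
  exists [::], 0, false; split=> //.
  - split; rewrite ?n2 ?r2 /= ?n1 /= ?r1 //.
  - split=> // u; rewrite in_nil; case: (rev u) => [|x q] //=.
    by rewrite before_nil !andbF.
  - by split=> //; rewrite -[t.+2]addn2.
move=> n m3 t3 w3 o3 s3 [pre [cu [down [ps -> pr pu ->]]]].
have [d cE st fE' FE' gE' ch inn le dn] := ps.
rewrite /= cE d (input_rows s3) leqn0 size_eq0.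
case: leqP => [Mc|cM] /=.
  have {Mc} cuM : cu = M by apply/eqP; rewrite eqn_leq le Mc.
  (* [down] promises an acceptable candidate between the cursor and [M], so an exhausted cursor, and
     with it any pop, belongs to an ascent. *)
  rewrite {}cuM in cE ps pr pu dn *; have dnF : down = false.
    by case: (down) dn => // /(_ isT)[j [Mj /andP[]]]; rewrite ltnNge Mj.
  subst down; case: eqP => /= [pE|/eqP pN].
    apply: wp_nil => //; subst pre; case: pr => u1 u2; split=> //; last first.
      by apply: punctual_le pu; rewrite /printing; lia.
    (* With an empty stack and the cursor at [M], every solution precedes [[:: M]], since its first
       index is below [M]. *)
    move=> u; rewrite u2; case: (boolP (sol (rev u))) => //= su.
    have [aM _] := chain_bounds (sol_chain su).
    by case: (rev u) aM => //= x q /andP[-> _].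
  apply: wp_if => //; rewrite /= cE (input_rows s3) leqnn cats0.
  case/lastP: pre pN ps pr pu {d st ch inn dn} => [//|pre v] _ ps pr pu.
  by rewrite size_rcons in pu; apply: pop_correct.
apply: wp_if => //; rewrite [beval _ _]/= cE (input_rows s3) leqNgt cM cats0.
apply: wp_if => //; rewrite (accept_ok s3 ps cM) cats0.
case: ifPn => okc; last first.
  by rewrite -[t3.+3]addn3; exact: (skip_correct s3 ps cM okc pr pu).
apply: wp_nwrite => //; try by rewrite /= ?d ?cE; have := (chain_bounds ch).2; lia.
move=> m4 s4 n4 r4; rewrite /= d cE in n4.
apply: wp_if => //; rewrite nat_eqE cats0.
have -> : neval m4 (src_of cur) = sr cu.
  by rewrite /= n4 /= cE (input_rows s3).
have -> : neval m4 nsource = s by rewrite /= n4 /= (input_rows s3).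
have -> : t3.+1.+4 = t3 + 5 by lia.
case: eqP => [es|/eqP ns].
  exact: emit_correct s4 ps cM okc es pr pu n4 r4.
exact: push_correct s4 ps cM okc ns pr pu n4 r4.
Qed.
End Search.

Local Arguments mcea_input : simpl never.

(** * Paths and their encodings *)

Section Instance.
Variables (R : realType) (x : mcea_instance R).
Hypothesis pos : positive_costs (graph x).
Local Notation m0 := (mcea_input x).
Local Notation E := (edges (graph x)).
Local Notation M := (nrd m0 0 1).
Local Notation s := (nrd m0 0 2).
Local Notation z := (nrd m0 0 3).
Local Notation c := (rrd m0 0).
Local Notation sr := (nrd m0 1).
Local Notation ds := (nrd m0 2).
Local Notation av := (nrd m0 3).
Local Notation tr := (nrd m0 4).
Local Notation btpath := (btpath M sr ds av tr s z).
Local Notation efficientb := (efficientb M sr ds av tr c s z).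
Local Notation fol := (fol sr ds av tr).
Local Notation idx e := (index e E).

Lemma input_nth (T : Type) (d : T) (f : tedge R (nvert (graph x)) -> T) e :
  e \in E -> nth d (map f E) (idx e) = f e.
Proof. by move=> eE; rewrite (nth_map e) ?index_mem // nth_index. Qed.

Lemma src_idx e : e \in E -> sr (idx e) = src e.
Proof. exact: (input_nth 0 (fun e => val (src e))). Qed.
Lemma dst_idx e : e \in E -> ds (idx e) = dst e.
Proof. exact: (input_nth 0 (fun e => val (dst e))). Qed.
Lemma avail_idx e : e \in E -> av (idx e) = avail e.
Proof. exact: input_nth. Qed.
Lemma trav_idx e : e \in E -> tr (idx e) = trav e.
Proof. exact: input_nth. Qed.
Lemma cost_idx e : e \in E -> c (idx e) = cost e.
Proof. exact: input_nth. Qed.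

Lemma idx_lt e : e \in E -> idx e < M.
Proof. by rewrite -index_mem. Qed.

Lemma idx_surj i : i < M -> exists2 e, e \in E & idx e = i.
Proof.
rewrite /read /= => iM; case EE: E => [|e0 E']; first by rewrite EE in iM.
exists (nth e0 E i); first by rewrite -EE mem_nth.
by rewrite -EE index_uniq // edges_uniq.
Qed.

Lemma cost_idx_gt0 i : i < M -> (0 < c i)%R.
Proof. by move/idx_surj=> [e eE <-]; rewrite cost_idx // (allP pos). Qed.

Lemma encode_surj q : all (gtn M) q ->
  exists2 P, all (mem E) P & encode_path P = q.
Proof.
elim: q => [|i q ih] /=; first by exists [::].
case/andP=> /idx_surj[e eE <-] /ih[P PE <-].
by exists (e :: P) => //=; rewrite eE.
Qed.

Lemma follows_idx e f : e \in E -> f \in E -> fol (idx e) (idx f) = follows e f.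
Proof.
move=> eE fE; rewrite /fol /follows dst_idx // src_idx // !avail_idx //.
by rewrite trav_idx.
Qed.

Lemma btpath_rev i w : btpath (rev (i :: w)) =
  [&& all (gtn M) (i :: w), sr i == s, path fol i w, ds (last i w) == z &
      uniq (s :: map ds (i :: w))].
Proof.
have : rev (i :: w) = last i w :: rev (belast i w) by rewrite lastI rev_rcons.
move=> qE; have li : last (last i w) (rev (belast i w)) = i.
  by rewrite -(last_cons 0) -qE rev_cons last_rcons.
rewrite /btpath qE /bwalk li -qE all_rev rev_path map_rev.
rewrite [uniq (s :: rev _)]cons_uniq mem_rev rev_uniq -cons_uniq.
by rewrite -!andbA; do !bool_congr.
Qed.

Lemma tpath_btpath P : all (mem E) P ->
  tpath (source x) (target x) P = btpath (rev (encode_path P)).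
Proof.
case: P => [|e P] // PE.
rewrite (_ : encode_path (e :: P) = idx e :: [seq idx f | f <- P]) // btpath_rev.
have /andP[eE PE'] : (e \in E) && all (mem E) P by [].
have -> : all (gtn M) (idx e :: [seq idx f | f <- P]).
  apply/allP => i /(@mapP _ _ (fun e => idx e) (e :: P))[f fP ->].
  by apply: idx_lt; apply: (allP PE).
rewrite /tpath [all _ _]PE src_idx // (last_map (fun f => idx f)) [LHS]/=; congr [&& _, _, _ & _].
- apply/esym/(mono_path_in (P := mem E)) => //.
  by move=> f g fE gE; apply: follows_idx.
- by rewrite dst_idx //; apply: (allP PE); apply: mem_last.
have -> : [seq ds i | i <- idx e :: [seq idx f | f <- P]] =
    map val (map (@dst R _) (e :: P)).
  rewrite (_ : idx e :: _ = [seq idx f | f <- e :: P]) // -!map_comp.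
  apply/eq_in_map => f fP /=; apply: dst_idx; exact: (allP PE).
exact/esym/(map_inj_uniq val_inj (source x :: map (@dst R _) (e :: P))).
Qed.

Lemma wcost_encode P : all (mem E) P ->
  wcost c (rev (encode_path P)) = path_cost P.
Proof.
move/allP=> PE; rewrite /wcost /path_cost (perm_big (encode_path P)) ?perm_rev //= big_map.
by apply: eq_big_seq => e /PE; apply: cost_idx.
Qed.

(** Nonemptiness matters: on the empty list [head 0] would denote the edge with index 0. *)
Lemma arrival_encode P : all (mem E) P -> P != [::] ->
  arr av tr (head 0 (rev (encode_path P))) = arrival P.
Proof.
case: P => // e P PE _; 
have -> : rev (encode_path (e :: P)) = idx (last e P) :: rev (encode_path (belast e P)).
  by rewrite /encode_path lastI map_rcons rev_rcons.
have -> : arrival (e :: P) = avail (last e P) + trav (last e P).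
  by rewrite /arrival /= (last_map (fun f => avail f + trav f)).
have lE : last e P \in E by apply: (allP PE); apply: mem_last.
by rewrite /arr /= avail_idx // trav_idx.
Qed.

Lemma tpath_mem P : tpath (source x) (target x) P -> all (mem E) P /\ P != [::].
Proof. by case: P => // e P /and5P[]. Qed.

Lemma efficient_encode P : all (mem E) P ->
  efficient (source x) (target x) P <-> efficientb (rev (encode_path P)).
Proof.
move=> PE; rewrite /efficient /efficientb -tpath_btpath //.
split=> -[tP nd]; split=> // -[].
  move=> q [tq h].
  have [q0 bq] : q != [::] /\ all (gtn M) q.
    by case: q tq {h} => // i q /and3P[/and3P[]].
  have [Q QE qE] : exists2 Q, all (mem E) Q & encode_path Q = rev q.
    by apply: encode_surj; rewrite all_rev.
  have {qE} qE : q = rev (encode_path Q) by rewrite qE revK.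
  subst q; rewrite -tpath_btpath // in tq; apply: nd; exists Q; split=> //.
  move: h; rewrite !wcost_encode // !arrival_encode //.
    exact: (tpath_mem tP).2.
  exact: (tpath_mem tq).2.
move=> Q [tQ h]; have [QE Q0] := tpath_mem tQ; apply: nd.
exists (rev (encode_path Q)); rewrite -tpath_btpath // !wcost_encode //.
by rewrite !arrival_encode // (tpath_mem tP).2.
Qed.

Lemma efficientb_bounded q : efficientb q -> all (gtn M) q.
Proof. by case=> + _; case: q => // i q /and3P[/and3P[]]. Qed.

Lemma solution_efficientb w :
  (exists P, efficient (source x) (target x) P /\ w = encode_path P) <->
  efficientb (rev w).
Proof.
split=> [[P [eP ->]]|ew].
  by apply/efficient_encode => //; case: eP => /tpath_mem[].
have [P PE wE] : exists2 P, all (mem E) P & encode_path P = w.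
  by apply: encode_surj; rewrite -all_rev; apply: efficientb_bounded.
by exists P; split=> //; apply/efficient_encode; rewrite // wE.
Qed.

Lemma safe_input : safe m0 9 2 (M + 8) m0.
Proof.
split=> //; first by move=> [|[|[|[|[|y]]]]] // _; rewrite nth_default.
by move=> [|[|y]] //=; rewrite ?size_map ?leq_addr // nth_default.
Qed.
End Instance.

(** * Space of a safe memory *)

Lemma bitlen_le k : bitlen k <= k.+1.
Proof.
rewrite /bitlen ltnS; case: k => // k.
apply: leq_trans (trunc_logP (ltnSn 1) (ltn0Sn k)).
exact/ltnW/ltn_expl.
Qed.

Lemma sum_rows (T : Type) (f : seq T -> nat) (a : seq (seq T)) n :
  f [::] = 0 -> size a <= n ->
  \sum_(r <- a) f r = \sum_(0 <= i < n) f (nth [::] a i).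
Proof.
move=> f0 an; rewrite (big_nth [::]) (big_cat_nat _ an) //=.
rewrite [X in _ + X]big1_seq ?addn0 // => i /andP[_].
by rewrite mem_index_iota => /andP[ai _]; rewrite nth_default.
Qed.

(** Rows 5 to 8 are the four natural work arrays, each with at most [A] cells of at most [A.+1]
    bits; both real arrays have at most [A] cells. *)
Lemma safe_space (R : realType) (m0 m : memory R) A :
  size (nmem m0) = 5 -> safe m0 9 2 A m ->
  Defs.space m <= Defs.space m0 + 4 * (A * A.+1) + 2 * A.
Proof.
move=> m05 [[sn sr] inp bnd _ rbnd]; rewrite /Defs.space.
pose f (a : seq nat) := \sum_(k <- a) bitlen k.
have f0 : f [::] = 0 by rewrite /f big_nil.
rewrite (sum_rows f0 sn) (@sum_rows _ size _ 2) // (@sum_rows _ f _ 5) ?m05 //.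
rewrite (@big_cat_nat _ _ _ 5) //=.
have -> : \sum_(0 <= i < 5) f (nth [::] (nmem m) i) =
          \sum_(0 <= i < 5) f (nth [::] (nmem m0) i).
  by apply: eq_big_nat => i /andP[_ i5]; rewrite inp.
have h1 : \sum_(5 <= i < 9) f (nth [::] (nmem m) i) <= 4 * (A * A.+1).
  apply: (@leq_trans (\sum_(5 <= i < 9) A * A.+1)); last first.
    by rewrite sum_nat_const_nat.
  rewrite !big_nat; apply: leq_sum => i /andP[i5 _].
  have [sz /allP al] := bnd i i5.
  apply: (@leq_trans (\sum_(k <- nth [::] (nmem m) i) A.+1)).
    rewrite /f !big_seq; apply: leq_sum => k /al kA.
    exact: leq_trans (bitlen_le k) _.
  by rewrite big_const_seq count_predT iter_addn_0 mulnC leq_mul2r sz orbT.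
have h2 : \sum_(0 <= i < 2) size (nth [::] (rmem m) i) <= 2 * A.
  by rewrite !big_nat_recr //= big_geq //; have := rbnd 0; have := rbnd 1; lia.
lia.
Qed.

(** * The enumeration algorithm *)

Definition mcea_program : program :=
  init_labels ++ bellman_ford ++ mark_good ++ depth_first.

(** Cubic because of the three nested relaxation loops; 100 is a generous constant that also absorbs
    the quadratic search and the printing. *)
Definition delay_bound N := 100 * N.+1 ^ 3.

Lemma mcea_program_correct (R : realType) (x : mcea_instance R) D :
  positive_costs (graph x) -> delay_bound (nrd (mcea_input x) 0 1) <= D ->
  wp (mcea_input x) 9 2 (nrd (mcea_input x) 0 1 + 8) mcea_program
    (fun m t w o => [/\ uniq (map snd o),
       forall u, u \in map snd o <->
         exists P, efficient (source x) (target x) P /\ u = encode_path P &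
       punctual D t o]) (mcea_input x) 0 [::] [::].
Proof.
move=> pos; set m0 := mcea_input x; set M := nrd m0 0 1 => DM.
have c0 : forall e, e < M -> (0 < rrd m0 0 e)%R := cost_idx_gt0 pos.
have fin0 i : nrd m0 6 i = 0 by rewrite /read /= !nth_nil.
have bound : 7 * (M * M.+2 + M + M.+1 * M.+2) + printing m0
   + (2 + M * 5 + (2 + M * (2 + M * (2 + M * 5).+2).+2) + (2 + M * (4 + M * 4).+2)) + 2
   < D.
  apply: leq_trans DM; rewrite /delay_bound /printing -/M; move: (M) => k.
  rewrite !expnS expn0; nia.
apply: (calc_wp (init_labels_correct fin0)) => [|m1 t1 s1 [sn1 cm1] t1b].
  exact: safe_input.
apply: (calc_wp (bellman_ford_correct c0 sn1 cm1)) => // m2 t2 s2 sp2 t2b.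
apply: (calc_wp (mark_good_correct (m := m2))) => // m3 t3 s3 [n3 r3 g3] t3b.
apply: wp_weaken.
  apply: (dfs_correct (D := D) c0 sp2 _ s3 n3 _ g3).
  - by move: bound; rewrite -/M; lia.
  - by rewrite r3.
  - move: bound t1b t2b t3b; rewrite /phase -/M subn0; lia.
move=> m t w o _ [u1 u2 pu]; split=> // u.
rewrite u2 solution_efficientb; split.
  by case: (rev u) => // e p; apply: sol_efficient.
exact: efficient_sol.
Qed.

Lemma horner_power (a b k n : nat) :
  ((a%:P * ('X + b%:P) ^+ k)%R : {poly nat}).[n]%R = a * (n + b) ^ k.
Proof. by rewrite hornerM horner_exp hornerD !hornerC hornerX natrXE natrDE. Qed.

Theorem theorem5 (R : realType) : PSDelayP (MceaEnum_pos R).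
Proof.
(* The first polynomial is [delay_bound]. In the second, 9 comes from [A.+1] with [A = M + 8], and 8
   covers the four work arrays, the reals and the input. *)
exists mcea_program, ((100%:P * ('X + 1%:P) ^+ 3)%R), ((8%:P * ('X + 9%:P) ^+ 2)%R).
case=> x pos; rewrite !horner_power /=; set N := nvert _ + _.
(* The cost array alone contributes one unit per edge to the input size. *)
have MN : nrd (mcea_input x) 0 1 <= N.
  rewrite /N /Defs.space [\sum_(a <- rmem _) _]big_seq1 size_map addnA leq_addl //.
pose D := delay_bound N.
have DM : delay_bound (nrd (mcea_input x) 0 1) <= D.
  by rewrite leq_mul2l leq_exp2r.
have [m [t [w [o [rch _ [u1 u2 [p1 p2]]]]]]] := mcea_program_correct pos DM [::].
rewrite cats0 in rch; have [T [ET sT]] := reach_iter rch; split.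
  exists T; rewrite /run ET; split; first by split.
  by rewrite /delay_le /= rcons_path addn1 p1 p2.
have szA : forall m, safe (mcea_input x) 9 2 (nrd (mcea_input x) 0 1 + 8) m ->
  Defs.space m <= (8 * (N + 9) ^ 2)%N.
  move=> m' /safe_space -/(_ erefl); move: MN.
  rewrite /N; move: (Defs.space _) (nrd _ 0 1) (nvert _) => a b k; rewrite expnS expn1; nia.
(* Beyond [T] no code remains, so [step] leaves the configuration fixed and its memory stays
   safe. *)
move=> t'; apply: szA; case: (leqP t' T) => [/sT //|Tt'].
rewrite /run -(subnK (ltnW Tt')) iterD ET iter_fix //.
by have := sT T (leqnn T); rewrite ET.
Qed.
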